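(* Assume the inhomogeneities satisfy $\xi_i\neq\xi_j\bmod\eta$ for all $i\ne j$ in $\{1,\dots,N\}$, and let $K$ be an invertible $2\times2$ matrix, not proportional to the identity, with eigenvalues $\mathsf k_1,\mathsf k_2$. Below $\mathbf h=(h_1,\dots,h_N)$ with $h_n\in\{0,\dots,2s_n\}$. a) If $K_{12}\neq0$, the co-vectors $$\langle\mathbf h|_{Sk}=\langle h_1,\dots,h_N|_{Sk}=\langle0|\prod_{n=1}^N\prod_{k=0}^{h_n-1}\frac{\mathsf A^{(K)}(\xi_n^{(k)})}{\mathsf k_1a(\xi_n^{(k)})}$$ form a co-vector eigenbasis of $\mathcal H$ for $\mathsf B^{(K)}$: $$\langle\mathbf h|_{Sk}\mathsf B^{(K)}(\lambda)=K_{12}\prod_{n=1}^N(\lambda-\xi_n^{(h_n)})\,\langle\mathbf h|_{Sk},$$ with distinct eigenvalues for distinct $\mathbf h$. Moreover $$\langle\mathbf h|_{Sk}\mathsf A^{(K)}(\lambda)=\sum_{i=1}^N\prod_{j\ne i}\frac{\lambda-\xi_j^{(h_j)}}{\xi_i^{(h_i)}-\xi_j^{(h_j)}}\,\mathsf k_1a(\xi_i^{(h_i)})\,\langle\mathbf h|_{Sk}\mathrm T_i^+,$$ $$\langle\mathbf h|_{Sk}\mathsf D^{(K)}(\lambda)=\sum_{i=1}^N\prod_{j\ne i}\frac{\lambda-\xi_j^{(h_j)}}{\xi_i^{(h_i)}-\xi_j^{(h_j)}}\,\mathsf k_2d(\xi_i^{(h_i)})\,\langle\mathbf h|_{Sk}\mathrm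 T_i^-,$$ where $\langle h_1,\dots,h_i,\dots,h_N|_{Sk}\mathrm T_i^\pm=\langle h_1,\dots,h_i\pm1,\dots,h_N|_{Sk}$ (co-vectors with an index out of range being zero by convention), while the action of $\mathsf C^{(K)}(\lambda)$ is uniquely defined by the quantum determinant relation. b) If $K_{12}=0$, let $W$ be an invertible $2\times2$ matrix such that $\bar K=W^{-1}KW$ has $\bar K_{12}\neq0$, $\bar K_{21}\ne0$, and let $\mathcal W$ be the induced operator on $\mathcal H$. Put $\tilde{\mathsf A}^{(K)}=\mathcal W\mathsf A^{(\bar K)}\mathcal W^{-1}$, $\tilde{\mathsf B}^{(K)}=\mathcal W\mathsf B^{(\bar K)}\mathcal W^{-1}$, $\tilde{\mathsf D}^{(K)}=\mathcal W\mathsf D^{(\bar K)}\mathcal W^{-1}$. Then the co-vectors $$\underline{\langle\mathbf h|}_{Sk}=\langle0|\prod_{n=1}^N\prod_{k=0}^{h_n-1}\frac{\mathsf A^{(\bar K)}(\xi_n^{(k)})}{\mathsf k_1a(\xi_n^{(k)})}\mathcal W^{-1}=\langle0|\mathcal W^{-1}\prod_{n=1}^N\prod_{k=0}^{h_n-1}\frac{\tilde{\mathsf A}^{(K)}(\xi_n^{(k)})}{\mathsf k_1a(\xi_n^{(k)})}$$ form a co-vector eigenbasis of $\mathcal H$ for $\tilde{\mathsf B}^{(K)}$: $$\underline{\langle\mathbf h|}_{Sk}\tilde{\mathsf B}^{(K)}(\lambda)=\bar K_{12}\prod_{n=1}^N(\lambda-\xi_n^{(h_n)})\,\underline{\langle\mathbf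 h|}_{Sk}.$$ Moreover $$\underline{\langle\mathbf h|}_{Sk}\tilde{\mathsf A}^{(K)}(\lambda)=\sum_{i=1}^N\prod_{j\ne i}\frac{\lambda-\xi_j^{(h_j)}}{\xi_i^{(h_i)}-\xi_j^{(h_j)}}\,\mathsf k_1a(\xi_i^{(h_i)})\,\underline{\langle\mathbf h|}_{Sk}\mathrm T_i^+,$$ $$\underline{\langle\mathbf h|}_{Sk}\tilde{\mathsf D}^{(K)}(\lambda)=\sum_{i=1}^N\prod_{j\ne i}\frac{\lambda-\xi_j^{(h_j)}}{\xi_i^{(h_i)}-\xi_j^{(h_j)}}\,\mathsf k_2d(\xi_i^{(h_i)})\,\underline{\langle\mathbf h|}_{Sk}\mathrm T_i^-,$$ with $\mathrm T_i^{\pm}$ shifting $h_i$ to $h_i\pm1$ in the same way.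
   Context: Setting. Let $\eta\in\mathbb{C}\setminus\{0\}$, $N\ge1$, and let $s_1,\dots,s_N$ be spins with $2s_n\in\mathbb{Z}_{>0}$. Let $V_n=\mathbb{C}^{2s_n+1}$ and $\mathcal H=\bigotimes_{n=1}^N V_n$. On $V_n$ let $S_n^z=\mathrm{diag}(s_n,s_n-1,\dots,-s_n)$, let $S_n^+$ be the matrix with only nonzero entries $(S_n^+)_{j,j+1}=\sqrt{j(2s_n+1-j)}$, $1\le j\le 2s_n$, and let $S_n^-=(S_n^+)^t$. With auxiliary space $V_0=\mathbb{C}^2$, the Lax operator is $$\mathsf L_{0n}(\lambda)=\begin{pmatrix}\lambda+\eta(\tfrac12+S_n^z)&\eta S_n^-\\ \eta S_n^+&\lambda+\eta(\tfrac12-S_n^z)\end{pmatrix}_{[0]}.$$ For a $2\times2$ matrix $K=(K_{ij})$ and inhomogeneities $\xi_1,\dots,\xi_N\in\mathbb{C}$, the monodromy matrix is $$\mathsf M_0^{(K)}(\lambda)=K_0\mathsf L_{0N}(\lambda-\xi_N)\cdots\mathsf L_{01}(\lambda-\xi_1)=\begin{pmatrix}\mathsf A^{(K)}(\lambda)&\mathsf B^{(K)}(\lambda)\\\mathsf C^{(K)}(\lambda)&\mathsf D^{(K)}(\lambda)\end{pmatrix}_{[0]},$$ with entries in $\mathrm{End}(\mathcal H)$. For each of the four entries, the operators at different spectral parameters commute. Notation. $\xi_n^{(k)}=\xi_n-\tfrac\eta2+(s_n-k)\eta$, $a(\lambda)=\prod_{n=1}^N(\lambda-\xi_n^{(2s_n)})$,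 $d(\lambda)=\prod_{n=1}^N(\lambda-\xi_n^{(0)})$. The quantum determinant relation is $\mathsf A^{(K)}(\lambda)\mathsf D^{(K)}(\lambda-\eta)-\mathsf B^{(K)}(\lambda)\mathsf C^{(K)}(\lambda-\eta)=\mathsf k_1\mathsf k_2a(\lambda)d(\lambda-\eta)$. The co-vector $\langle0|=\bigotimes_n(1,0,\dots,0)\in\mathcal H^*$ is the left reference state; co-vectors are acted upon by operators from the right, and a ''co-vector basis of $\mathcal H$'' is a basis of $\mathcal H^*$. Note $a(\xi_n^{(2s_n)})=0=d(\xi_n^{(0)})$. Induced operator. For an invertible $2\times2$ matrix $W$, $\mathcal W=\bigotimes_{n=1}^NW_n$, where $W_n$ is the action of $W^{\otimes 2s_n}$ on $\mathrm{Sym}^{2s_n}(\mathbb{C}^2)$, identified with $V_n$ as the spin-$s_n$ representation (the $j$-th basis vector of $V_n$ corresponds to the normalized symmetric tensor with $2s_n+1-j$ factors $e_1$ and $j-1$ factors $e_2$).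
   Formalization: The A and D actions carry the missing leading terms K_11 (resp. K_22; in b the entries of K̄) times ∏(λ−ξ_j^(h_j))⟨h|; for spins with 2s_i, 2s_j of different parity, ξ_i^(k) ≠ ξ_j^(l) is also assumed for all k ≤ 2s_i, l ≤ 2s_j. *)

(* Defs.v *)
From HB Require Import structures.
#[export] Set Warnings "-notation-overridden,-ambiguous-paths".
From mathcomp Require Export all_boot all_order all_algebra.
From mathcomp Require Export reals.
From mathcomp.real_closed Require Export complex.

Set Implicit Arguments.
Unset Strict Implicit.
Unset Printing Implicit Defensive.
Import Order.TTheory GRing.Theory Num.Theory.
Local Open Scope ring_scope.
Local Open Scope complex_scope.

Section TensorSpaces.
Variables (C : pzRingType) (N : nat) (t : 'I_N -> nat).

(* The space (x)_n C^(t n + 1) is represented in its product basis, labelled by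
   the multi-indices x with x n in {0, ..., t n}. MathComp matrices have ordinal
   indices, so multi-indices are numbered by enum_val; the numbering
   itself plays no role. *)
Definition mindex : finType := {dffun forall n : 'I_N, 'I_(t n).+1}.
Definition tdim := #|{: mindex}|.
Definition label (x : 'I_tdim) : mindex := enum_val x.

Definition tens_mx (A : forall n : 'I_N, 'M[C]_((t n).+1)) : 'M[C]_tdim :=
  \matrix_(x, y) \prod_(n < N) A n (label x n) (label y n).

(* id (x) ... (x) O (x) ... (x) id, with O on the n-th factor *)
Definition at_site (n : 'I_N) (O : 'M[C]_((t n).+1)) : 'M[C]_tdim :=
  \matrix_(x, y) (O (label x n) (label y n) *
    \prod_(m < N | m != n) (label x m == label y m)%:R).

Definition bra0 : 'rV[C]_tdim :=
  \row_x \prod_(n < N) (label x n == ord0)%:R.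

(* A family of co-vectors extended by zero to out-of-range multi-indices *)
Definition ext_bra (F : mindex -> 'rV[C]_tdim) (h : 'I_N -> int) :
    'rV[C]_tdim :=
  if [pick x : mindex | [forall n, (nat_of_ord (x n))%:Z == h n]] is Some x
  then F x else 0.

(* T_i^+ is shift_bra F i 1 and T_i^- is shift_bra F i (-1) *)
Definition shift_bra (F : mindex -> 'rV[C]_tdim) (i : 'I_N) (e : int)
    (h : mindex) : 'rV[C]_tdim :=
  ext_bra F (fun n => (nat_of_ord (h n))%:Z + (if n == i then e else 0)).

End TensorSpaces.

Section SpinOperators.
Variable C : numClosedFieldType.

(* t stands for 2s; indices start at 0, so that the j of the usual formulas
   is i.+1 here. *)
Definition spin_z (t : nat) : 'M[C]_(t.+1) :=
  \matrix_(i, j) ((t%:R / 2%:R - i%:R) *+ (i == j)).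
Definition spin_plus (t : nat) : 'M[C]_(t.+1) :=
  \matrix_(i, j) (sqrtC (i.+1%:R * (t - i)%:R) *+ (j == i.+1 :> nat)).
Definition spin_minus (t : nat) : 'M[C]_(t.+1) := (spin_plus t)^T.

(* The j-th column is the normalized symmetric tensor in (C^2)^{(x) t} with
   t - j factors e_1 and j factors e_2: the sum of the 'C(t, j) corresponding
   product vectors, divided by the square root of 'C(t, j). *)
Definition sym_basis (t : nat) : 'M[C]_(tdim (fun _ : 'I_t => 1%N), t.+1) :=
  \matrix_(x, j) ((sqrtC ('C(t, j))%:R)^-1
    *+ (#|[set n : 'I_t | label x n != ord0]| == j)).

(* The action of W^{(x) t} on Sym^t(C^2) in the basis given by the columns of
   sym_basis t. These are orthonormal with real entries and span a subspace
   stable under W^{(x) t}, so that coordinates are computed with the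
   transpose. *)
Definition sym_action (t : nat) (W : 'M[C]_2) : 'M[C]_(t.+1) :=
  (sym_basis t)^T *m tens_mx (fun _ : 'I_t => W) *m sym_basis t.

End SpinOperators.

Section Monodromy.
Variables (C : numClosedFieldType) (N : nat) (t : 'I_N -> nat).
Variables (eta : C) (xi : 'I_N -> C).
Local Notation End_H := 'M[C]_(tdim t).

Definition induced_op (W : 'M[C]_2) : End_H :=
  tens_mx (fun n => sym_action (t n) W).

Definition block2 (T : Type) (a b c d : T) : 'M[T]_2 :=
  \matrix_(i, j) if i == ord0 then (if j == ord0 then a else b)
                 else (if j == ord0 then c else d).

Definition Lax (n : 'I_N) (lam : C) : 'M[End_H]_2 :=
  let Sz := at_site (spin_z C (t n)) in
  let Sp := at_site (spin_plus C (t n)) in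
  let Sm := at_site (spin_minus C (t n)) in
  block2 ((lam + eta / 2%:R)%:M + eta *: Sz) (eta *: Sm)
         (eta *: Sp) ((lam + eta / 2%:R)%:M - eta *: Sz).

(* K L_N(lam - xi_N) ... L_1(lam - xi_1), a product of 2 x 2 matrices over the
   ring End(H); rev_ord puts the last site to the left. *)
Definition monodromy (K : 'M[C]_2) (lam : C) : 'M[End_H]_2 :=
  map_mx (fun c => c%:M) K *m
  \prod_(n < N) Lax (rev_ord n) (lam - xi (rev_ord n)).

Definition opA (K : 'M[C]_2) (lam : C) : End_H := monodromy K lam 0 0.
Definition opB (K : 'M[C]_2) (lam : C) : End_H := monodromy K lam 0 1.
Definition opC (K : 'M[C]_2) (lam : C) : End_H := monodromy K lam 1 0.
Definition opD (K : 'M[C]_2) (lam : C) : End_H := monodromy K lam 1 1.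

Definition node (n : 'I_N) (k : nat) : C :=
  xi n - eta / 2%:R + ((t n)%:R / 2%:R - k%:R) * eta.

Definition fun_a (lam : C) : C := \prod_(n < N) (lam - node n (t n)).
Definition fun_d (lam : C) : C := \prod_(n < N) (lam - node n 0).

(* xi_i <> xi_j mod eta for i <> j. When 2 s_i and 2 s_j have different
   parities, xi_i^(k) - xi_j^(l) differs from xi_i - xi_j by a half-integer
   multiple of eta, and the first clause does not prevent it from vanishing;
   the second clause requires then that the denominators
   xi_i^(k) - xi_j^(l) be nonzero. For spins of the same parity this
   is a consequence of the first clause. *)
Definition generic_inhom : Prop :=
  (forall i j : 'I_N, i != j -> forall m : int, xi i - xi j != m%:~R * eta) /\
  (forall i j : 'I_N, i != j -> odd (t i) != odd (t j) ->
     forall k l : nat, (k <= t i)%N -> (l <= t j)%N -> node i k != node j l).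

(* <0| prod_n prod_{k < h_n} O(xi_n^(k)) / (k1 a(xi_n^(k))) *)
Definition covec (v : 'rV[C]_(tdim t)) (O : C -> End_H) (k1 : C)
    (h : mindex t) : 'rV[C]_(tdim t) :=
  v *m \prod_(n < N) \prod_(k < h n)
         ((k1 * fun_a (node n k))^-1 *: O (node n k)).

Definition node_poly (h : mindex t) (lam : C) : C :=
  \prod_(n < N) (lam - node n (h n)).

Definition lagrange (h : mindex t) (i : 'I_N) (lam : C) : C :=
  \prod_(j < N | j != i)
    ((lam - node j (h j)) / (node i (h i) - node j (h j))).

(* A(lam) and D(lam) have degree N in lam, with leading coefficients K_11 and
   K_22 times the identity. The Lagrange sum over the N nodes has degree N - 1,
   so the interpolation formula carries the leading term c prod_n
   (lam - xi_n^(h_n)) <h|, which vanishes exactly when c = 0. *)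
Definition interp_action (F : mindex t -> 'rV[C]_(tdim t)) (c : C)
    (w : C -> C) (e : int) (h : mindex t) (lam : C) : 'rV[C]_(tdim t) :=
  (c * node_poly h lam) *: F h +
  \sum_(i < N) (lagrange h i lam * w (node i (h i))) *: shift_bra F i e h.

Definition covec_basis (F : mindex t -> 'rV[C]_(tdim t)) : Prop :=
  basis_of fullv [seq F h | h : mindex t].

Definition qdet_rel (k1 k2 : C) (A B X D : C -> End_H) : Prop :=
  forall lam, A lam *m D (lam - eta) - B lam *m X (lam - eta)
              = (k1 * k2 * fun_a lam * fun_d (lam - eta))%:M.

Definition poly_op (X : 'M[{poly C}]_(tdim t)) (lam : C) : End_H :=
  map_mx (fun p : {poly C} => p.[lam]) X.

End Monodromy.

(* Main.v *)
Require Import Defs.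
From mathcomp Require Import ring zify.
Set Implicit Arguments.
Unset Strict Implicit.
Unset Printing Implicit Defensive.
Import Order.TTheory GRing.Theory Num.Theory.
Local Open Scope ring_scope.

(* Write M(lam) = K L_N ... L_1. The gl_2 commutation relations of the spin
   matrices give the Yang-Baxter relation R(lam - mu) (M(lam) (x) M(mu)) =
   (M(mu) (x) M(lam)) R(lam - mu) for each Lax operator, hence for products of
   Lax operators at different sites; the Casimir of each spin gives the quantum
   determinant in the same way. If <v| is an eigen-co-vector of B with a zero
   at x in its eigenvalue, the exchange relations turn <v|A(x) and <v|D(x) into
   eigen-co-vectors in which this zero has moved to x - eta and to x + eta.
   Starting from <0|, A therefore produces the co-vectors <h|, which are nonzero
   because the quantum determinant allows D to undo each step, and which form a
   basis because their eigenvalues are distinct. A step beyond the range of h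
   leads to an eigenvalue outside the spectrum of B, hence to zero. This gives
   the actions of A and D at the zeros of the eigenvalue of B, and the action at
   other points follows by interpolation, both being polynomials of degree N with
   known leading coefficient. Part b) is part a) for W^-1 K W after conjugation by
   the induced operator, which is invertible because W |-> Sym^(2s) W is
   multiplicative. *)

(** * Operators on tensor products *)

Section Tensor.
Variables (C : comPzRingType) (N : nat) (t : 'I_N -> nat).

Lemma prod_sum_mindex (F : forall n, 'I_(t n).+1 -> C) :
  \prod_(n < N) \sum_(k < (t n).+1) F n k =
  \sum_(z < tdim t) \prod_(n < N) F n (label z n).
Proof.
pose P n := [ffun k : 'I_(t n).+1 => F n k].
transitivity (\prod_n \sum_(k : 'I_(t n).+1) P n k).
  by apply: eq_bigr => n _; apply: eq_bigr => k _; rewrite ffunE.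
under eq_bigr => n _ do rewrite (big_tag (fun n k => P n k) n).
rewrite bigA_distr_big_dep -big_fprod (reindex (@fprod_of_dffun _ _)) /=; last first.
  exact/onW_bij/fprod_of_dffun_bij.
rewrite (reindex (@label N t)) /=; last exact/onW_bij/enum_val_bij.
by apply: eq_bigr => z _; apply: eq_bigr => n _; rewrite ffunE fprodE.
Qed.

Lemma tens_mxM (A B : forall n, 'M[C]_((t n).+1)) :
  tens_mx A *m tens_mx B = tens_mx (fun n => A n *m B n).
Proof.
apply/matrixP => x y; rewrite !mxE.
under [RHS]eq_bigr => n _ do rewrite mxE.
rewrite (prod_sum_mindex (fun n k => A n (label x n) k * B n k (label y n))).
by apply: eq_bigr => z _; rewrite !mxE -big_split.
Qed.

Lemma prod_label_eq (x y : 'I_(tdim t)) :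
  \prod_(n < N) ((label x n == label y n)%:R : C) = (x == y)%:R.
Proof.
case: eqP => [->|/eqP nxy]; first by rewrite big1 // => n _; rewrite eqxx.
have [n neq] : exists n, label x n != label y n.
  apply/existsP; rewrite -negb_forall; apply: contra nxy => /forallP e.
  by apply/eqP/enum_val_inj/ffunP => n; apply/eqP.
by rewrite (bigD1 n) //= (negPf neq) mul0r.
Qed.

Lemma tens_mx1 : tens_mx (fun n => 1%:M : 'M[C]_((t n).+1)) = 1%:M.
Proof.
apply/matrixP => x y; rewrite !mxE -prod_label_eq.
by apply: eq_bigr => n _; rewrite mxE.
Qed.

(** Writing one-site operators as tensor products with identities elsewhere lets [tens_mxM] give all
    their products site by site. *)
Lemma at_siteE n (O : 'M[C]_((t n).+1)) :
  at_site O = tens_mx (dfwith (fun m => 1%:M : 'M[C]_((t m).+1)) O).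
Proof.
apply/matrixP => x y; rewrite !mxE [RHS](bigD1 n) //= dfwith_in; congr (_ * _).
by apply: eq_bigr => m nm; rewrite dfwith_out 1?(eq_sym n) // mxE.
Qed.

Lemma eq_tens_mx (A B : forall n, 'M[C]_((t n).+1)) :
  (forall n, A n = B n) -> tens_mx A = tens_mx B.
Proof.
by move=> e; apply/matrixP => x y; rewrite !mxE; apply: eq_bigr => n _; rewrite e.
Qed.

Lemma at_siteM n (O O' : 'M[C]_((t n).+1)) :
  at_site (O *m O') = at_site O *m at_site O'.
Proof.
rewrite !at_siteE tens_mxM; apply: eq_tens_mx => m.
by have [<-|nm] := eqVneq n m; rewrite ?dfwith_in // !dfwith_out // mul1mx.
Qed.

Lemma at_site_comm n m (O : 'M[C]_((t n).+1)) (O' : 'M[C]_((t m).+1)) :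
  n != m -> at_site O *m at_site O' = at_site O' *m at_site O.
Proof.
move=> nm; rewrite !at_siteE !tens_mxM; apply: eq_tens_mx => p.
have [<-|np] := eqVneq n p; last by rewrite (dfwith_out _ _ np) mul1mx mulmx1.
by rewrite dfwith_in dfwith_out 1?(eq_sym m) // mul1mx mulmx1.
Qed.

Lemma at_site1 n : at_site (1%:M : 'M[C]_((t n).+1)) = 1%:M.
Proof.
rewrite at_siteE -tens_mx1; apply: eq_tens_mx => m.
by have [<-|nm] := eqVneq n m; rewrite ?dfwith_in ?dfwith_out.
Qed.

Lemma at_siteZ n c (O : 'M[C]_((t n).+1)) : at_site (c *: O) = c *: at_site O.
Proof. by apply/matrixP => x y; rewrite !mxE mulrA. Qed.

Lemma at_siteD n (O O' : 'M[C]_((t n).+1)) :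
  at_site (O + O') = at_site O + at_site O'.
Proof. by apply/matrixP => x y; rewrite !mxE mulrDl. Qed.

End Tensor.

(** * Yang-Baxter algebra *)

Lemma ord2P (T : 'I_2 -> Prop) : T 0 -> T 1 -> forall i, T i.
Proof.
move=> T0 T1 [[|[|//]] lti].
  by rewrite (_ : Ordinal lti = 0) //; apply/val_inj.
by rewrite (_ : Ordinal lti = 1) //; apply/val_inj.
Qed.

Lemma det2 (R : comPzRingType) (A : 'M[R]_2) :
  \det A = A 0 0 * A 1 1 - A 0 1 * A 1 0.
Proof.
rewrite (expand_det_row _ 0) !big_ord_recl big_ord0 addr0 /cofactor !det_mx11.
rewrite !mxE /= expr0 expr1 !mul1r mulN1r mulrN.
by congr (A _ _ * A _ _ - A _ _ * A _ _); apply/val_inj.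
Qed.

Section YangBaxter.
Variables (C : numClosedFieldType) (m : nat) (eta : C).
Local Notation E := 'M[C]_m.
Let sc0 : (0%:M : E) = 0 := raddf0 _.
Implicit Types (P Q : 'M[E]_2) (x : C).

Let scale_mull x (a b : E) : x *: (a * b) = (x *: a) * b.
Proof. exact: scalemxAl. Qed.
Let scale_mulr x (a b : E) : x *: (a * b) = a * (x *: b).
Proof. exact: scalemxAr. Qed.

Definition comm2 P Q := forall i j k l, P i j * Q k l = Q k l * P i j.

Lemma comm2_sym P Q : comm2 P Q -> comm2 Q P.
Proof. by move=> c i j k l; rewrite c. Qed.

Lemma comm2M P Q Q' : comm2 P Q -> comm2 P Q' -> comm2 P (Q *m Q').
Proof.
move=> c c' i j k l; rewrite mxE mulr_sumr mulr_suml.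
by apply: eq_bigr => a _; rewrite mulrA c -mulrA c' mulrA.
Qed.

(* [P] and [Q] stand for [T (lam)] and [T (mu)] with [x = lam - mu]; this is
   R(x) (P (x) Q) = (Q (x) P) R(x) for the rational R-matrix, entry by entry. *)
Definition rtt x P Q := forall i j k l,
  x *: (P i j * Q k l) + eta *: (P k j * Q i l) =
  x *: (Q k l * P i j) + eta *: (Q k j * P i l).

(** The commutation hypotheses bring the factors of each product together; the R-matrix then passes
    first through [P] and [Q], next through [P'] and [Q']. *)
Lemma rttM x P P' Q Q' : comm2 P' Q -> comm2 Q' P ->
  rtt x P Q -> rtt x P' Q' -> rtt x (P *m P') (Q *m Q').
Proof.
move=> cP cQ rPQ rPQ' i j k l.
have mulE (A A' B B' : 'M[E]_2) i1 j1 i2 j2 : comm2 A' B ->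
    (A *m A') i1 j1 * (B *m B') i2 j2 =
    \sum_a \sum_b (A i1 a * B i2 b) * (A' a j1 * B' b j2).
  move=> c; rewrite !mxE mulr_suml; apply: eq_bigr => a _; rewrite mulr_sumr.
  by apply: eq_bigr => b _; rewrite !mulrA -[_ * A' a j1 * B i2 b]mulrA c !mulrA.
rewrite !mulE // !scaler_sumr -!big_split /=.
transitivity (\sum_a \sum_b
    (x *: (Q k b * P i a) + eta *: (Q k a * P i b)) * (P' a j * Q' b l)).
  apply: eq_bigr => a _; rewrite !scaler_sumr -big_split; apply: eq_bigr => b _ /=.
  by rewrite !scale_mull -mulrDl -!scale_mull rPQ.
(* The inner indices [a] and [b] are exchanged in the [eta] term only, which transfers R to the
   second pair of factors. *)
transitivity (\sum_a \sum_b
    (Q k b * P i a) * (x *: (P' a j * Q' b l) + eta *: (P' b j * Q' a l))).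
  under eq_bigr => a _ do under eq_bigr => b _ do rewrite mulrDl.
  under [RHS]eq_bigr => a _ do under eq_bigr => b _ do rewrite mulrDr.
  under eq_bigr => a _ do rewrite big_split.
  under [RHS]eq_bigr => a _ do rewrite big_split.
  rewrite !big_split; congr (_ + _).
    by apply: eq_bigr => a _; apply: eq_bigr => b _; rewrite -scale_mull scale_mulr.
  rewrite /= exchange_big.
  by apply: eq_bigr => a _; apply: eq_bigr => b _; rewrite -scale_mull scale_mulr.
rewrite exchange_big /=; apply: eq_bigr => b _.
rewrite !scaler_sumr -big_split; apply: eq_bigr => a _ /=.
by rewrite rPQ' mulrDr !scale_mulr.
Qed.

(** This is the [GL_2] invariance of R: the entries are scalars, so both sides agree term by
    term. *)
Lemma rtt_const x (K : 'M[C]_2) :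
  let M := map_mx (fun c => c%:M : E) K in rtt x M M.
Proof.
move=> M i j k l; rewrite !mxE.
have cK (a b : C) : a%:M * b%:M = b%:M * a%:M :> E.
  by rewrite -!mulmxE -!scalar_mxM mulrC.
by rewrite cK [X in _ + _ *: X]cK.
Qed.

Lemma comm2_const (K : 'M[C]_2) P : comm2 (map_mx (fun c => c%:M : E) K) P.
Proof. by move=> i j k l; rewrite !mxE -mulmxE scalar_mxC. Qed.

(* With [Q] taken at [lam - eta], all four antisymmetrized products of the two
   columns reduce to the quantum determinant [delta]. *)
Definition qdet P Q (delta : C) := forall i k,
  P i 0 * Q k 1 - P i 1 * Q k 0 =
  (delta * ((i < k)%N%:R - (k < i)%N%:R))%:M.

(** Expanding over the two inner indices, the equal pairs cancel by [qP'] and the two unequal ones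
    give [d'] with opposite signs, which leaves an antisymmetrized product of [P] and [Q]. *)
Lemma qdetM P P' Q Q' d d' : comm2 P' Q ->
  qdet P Q d -> qdet P' Q' d' -> qdet (P *m P') (Q *m Q') (d * d').
Proof.
move=> c qP qP' i k; rewrite !mxE !big_ord_recl !big_ord0 !addr0 /=.
have -> : lift ord0 ord0 = 1 :> 'I_2 by apply/val_inj.
have reorder (a b e f : E) : b * e = e * b -> a * b * (e * f) = a * e * (b * f).
  by move=> cbe; rewrite !mulrA -[_ * b * e]mulrA cbe !mulrA.
rewrite !mulrDl !mulrDr !(reorder _ (P' _ _) (Q _ _)) //.
set a00 := P i 0 * Q k 0; set a01 := P i 0 * Q k 1.
set a10 := P i 1 * Q k 0; set a11 := P i 1 * Q k 1.
transitivity (a00 * (P' 0 0 * Q' 0 1 - P' 0 1 * Q' 0 0) +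
  a01 * (P' 0 0 * Q' 1 1 - P' 0 1 * Q' 1 0) +
  a10 * (P' 1 0 * Q' 0 1 - P' 1 1 * Q' 0 0) +
  a11 * (P' 1 0 * Q' 1 1 - P' 1 1 * Q' 1 0)).
  rewrite !mulrBr; apply/matrixP => u v.
  (* The noncommutative products become opaque matrices; the identity is linear in them and [ring]
     proves it entrywise. *)
  by do 8 (set z := _ * (_ * _); move: z => ?); rewrite !mxE; ring.
rewrite !qP' /= !subr0 !sub0r !mulr0 !mulr1 !sc0 !mulr0 add0r addr0.
rewrite mulrN mulr1 [(- d')%:M]raddfN mulrN -mulrBl qP.
by rewrite -mulmxE -scalar_mxM mulrAC mulrDr.
Qed.

Lemma qdet_const (K : 'M[C]_2) :
  let M := map_mx (fun c => c%:M : E) K in qdet M M (\det K).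
Proof.
move=> M i k; rewrite !mxE -!mulmxE -!scalar_mxM -raddfB; congr (_%:M).
by rewrite det2; elim/ord2P: i; elim/ord2P: k => /=; ring.
Qed.

Section Lax.
Variables (Z Sp Sm : E) (s : C).
Hypothesis ZSp : Z * Sp = Sp * Z + Sp.
Hypothesis ZSm : Z * Sm = Sm * Z - Sm.
(** These two relations encode both the commutator [2 Z] of [Sp] and [Sm] and the Casimir value
    [s (s + 1)]. *)
Hypothesis SpSm : Sp * Sm = (s * (s + 1))%:M - Z * Z + Z.
Hypothesis SmSp : Sm * Sp = (s * (s + 1))%:M - Z * Z - Z.

Let S : 'M[E]_2 := block2 Z Sm Sp (- Z).

Definition lax lam : 'M[E]_2 :=
  block2 ((lam + eta / 2%:R)%:M + eta *: Z) (eta *: Sm)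
         (eta *: Sp) ((lam + eta / 2%:R)%:M - eta *: Z).

Let laxE lam i j :
  lax lam i j = ((lam + eta / 2%:R) * (i == j)%:R)%:M + eta *: S i j.
Proof.
by elim/ord2P: i; elim/ord2P: j; rewrite !mxE //= ?mulr0 ?mulr1 ?sc0 ?add0r // scalerN.
Qed.

(** The [gl_2] commutation relations in a traceless realization; a single formula spares [lax_rtt] a
    case analysis. *)
Let gl2 i j k l : S i j * S k l =
  S k l * S i j + ((i == l)%:R *: S k j - (k == j)%:R *: S i l).
Proof.
elim/ord2P: i; elim/ord2P: j; elim/ord2P: k; elim/ord2P: l;
  rewrite !mxE //= ?mulrN ?mulNr ?ZSp ?ZSm ?SpSm ?SmSp;
  apply/matrixP => u v; repeat (set z := _ * _; move: z => ?); rewrite !mxE; ring.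
Qed.

(** In the exchange term the parts quadratic in [S] agree on both sides; what remains is linear in
    [S], and by [gl2] it compensates the commutator of [S i j] and [S k l]. *)
Lemma lax_rtt lam mu : rtt (lam - mu) (lax lam) (lax mu).
Proof.
move=> i j k l; rewrite !laxE !mulrDl !mulrDr.
rewrite -!mulmxE !mul_scalar_mx !mul_mx_scalar.
rewrite -!scalemxAl -!scalemxAr !mulmxE.
rewrite (gl2 i j k l) (gl2 k j i l).
apply/matrixP => u v; repeat (set z := _ * _ : E; move: z => ?).
move: (S i j) (S k l) (S k j) (S i l) => ????; rewrite !mxE; ring.
Qed.

(** The Casimir relations remove the quadratic terms; the scalar left is [lam^2 - eta^2 (s + 1/2)^2]
    in factorized form. *)
Lemma lax_qdet lam : qdet (lax lam) (lax (lam - eta))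
  ((lam + eta / 2%:R + s * eta) * (lam - eta / 2%:R - s * eta)).
Proof.
move=> i k; elim/ord2P: i; elim/ord2P: k; rewrite !mxE /=
  !mulrDl !mulrDr -!mulmxE ?(mulNmx, mulmxN) !mul_scalar_mx !mul_mx_scalar
  -!scalemxAl -!scalemxAr !mulmxE ?ZSp ?ZSm ?SpSm ?SmSp;
  apply/matrixP => u v; repeat (set z := _ * _ : E; move: z => ?);
  rewrite !mxE; by field.
Qed.


End Lax.
End YangBaxter.

(** * Polynomial functions *)

Section PolyFun.
Variable C : numClosedFieldType.
Implicit Types (d : nat) (c : C) (g : C -> C).

(** The coefficient [c] of degree [d] may vanish, so the degree bound and the leading term are
    propagated together. *)
Definition polyfun d c g := exists p : {poly C},
  [/\ forall x, g x = p.[x], (size p <= d.+1)%N & p`_d = c].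

Lemma polyfun_eq d c c' g g' :
  polyfun d c g -> c = c' -> g =1 g' -> polyfun d c' g'.
Proof. by move=> [p [gp sp cp]] <- e; exists p; split=> // x; rewrite -e. Qed.

Lemma polyfun_const c : polyfun 0 c (fun=> c).
Proof.
exists c%:P; split=> [x||]; rewrite ?hornerC ?coefC //.
by rewrite size_polyC; case: eqP.
Qed.

Lemma polyfun_cst0 d : polyfun d 0 (fun=> 0).
Proof. by exists 0; split=> [x||]; rewrite ?horner0 ?size_poly0 ?coef0. Qed.

Lemma polyfunD d c c' g g' :
  polyfun d c g -> polyfun d c' g' -> polyfun d (c + c') (fun x => g x + g' x).
Proof.
move=> [p [gp sp cp]] [q [gq sq cq]]; exists (p + q); split=> [x||].
- by rewrite hornerD gp gq.
- by rewrite (leq_trans (size_polyD _ _)) // geq_max sp.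
- by rewrite coefD cp cq.
Qed.

Lemma polyfunM d d' c c' g g' : polyfun d c g -> polyfun d' c' g' ->
  polyfun (d + d') (c * c') (fun x => g x * g' x).
Proof.
move=> [p [gp sp cp]] [q [gq sq cq]]; exists (p * q); split=> [x||].
- by rewrite hornerM gp gq.
- rewrite (leq_trans (size_polyMleq _ _)) //; move: (leq_add sp sq); lia.
- rewrite coefM -cp -cq.
  (* Only the index [d] of the convolution survives the two degree bounds. *)
  have ltd : (d < (d + d').+1)%N by rewrite ltnS leq_addr.
  rewrite (bigD1 (Ordinal ltd)) //= addKn big1 ?addr0 // => i.
  rewrite -val_eqE /= neq_ltn => /orP[lti|lti].
    rewrite [q`_ _]nth_default ?mulr0 // (leq_trans sq) //.
    lia.
  by rewrite nth_default ?mul0r // (leq_trans sp).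
Qed.

Lemma polyfun_sum d (I : Type) (r : seq I) (c : I -> C) (g : I -> C -> C) :
  (forall i, polyfun d (c i) (g i)) ->
  polyfun d (\sum_(i <- r) c i) (fun x => \sum_(i <- r) g i x).
Proof.
move=> pg; elim: r => [|i r IH].
  by rewrite big_nil; apply: (polyfun_eq (polyfun_cst0 d) erefl) => x; rewrite big_nil.
rewrite big_cons; apply: (polyfun_eq (polyfunD (pg i) IH) erefl) => x.
by rewrite big_cons.
Qed.

Lemma polyfunX : polyfun 1 1 id.
Proof. by exists 'X; split=> [x||]; rewrite ?hornerX ?size_polyX ?coefX. Qed.

Lemma polyfun_low d c : (0 < d)%N -> polyfun d 0 (fun=> c).
Proof.
move=> d0; exists c%:P; split=> [x||]; rewrite ?hornerC //.
  by rewrite size_polyC (leq_trans (leq_b1 _)).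
by rewrite coefC gtn_eqF.
Qed.

Variable m : nat.
Local Notation E := 'M[C]_m.

(** [M0] collects the leading coefficients; the indices [i], [j] are auxiliary and [x], [y] belong
    to the quantum space. *)
Definition polyfun_mx d (M0 : 'M[E]_2) (X : C -> 'M[E]_2) :=
  forall i j x y, polyfun d (M0 i j x y) (fun u => X u i j x y).

Lemma polyfun_mxM d d' M0 M0' X X' :
  polyfun_mx d M0 X -> polyfun_mx d' M0' X' ->
  polyfun_mx (d + d') (M0 *m M0') (fun u => X u *m X' u).
Proof.
move=> pX pX' i j x y.
have mulE (A A' : 'M[E]_2) : (A *m A') i j x y = \sum_a \sum_b A i a x b * A' a j b y.
  by rewrite mxE summxE; apply: eq_bigr => a _; rewrite mxE.
rewrite mulE; apply: (polyfun_eq _ erefl (fun u => esym (mulE _ _))).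
by apply: polyfun_sum => a; apply: polyfun_sum => b; apply: polyfunM.
Qed.

End PolyFun.

(** * Spin matrices *)

Section Spin.
Variables (C : numClosedFieldType) (t : nat).
Local Notation Z := (spin_z C t).
Local Notation Sp := (spin_plus C t).
Local Notation Sm := (spin_minus C t).

Let spin_zE : Z = diag_mx (\row_i (t%:R / 2%:R - i%:R)).
Proof. by apply/matrixP => i j; rewrite !mxE. Qed.

Lemma spin_z_plus : Z *m Sp = Sp *m Z + Sp.
Proof.
rewrite spin_zE mul_diag_mx mul_mx_diag; apply/matrixP => i j; rewrite !mxE.
by case: eqP => [->|_]; rewrite ?mulr0n ?mulr1n; [ring | rewrite mulr0 mul0r addr0].
Qed.

Lemma spin_z_minus : Z *m Sm = Sm *m Z - Sm.
Proof.
rewrite spin_zE mul_diag_mx mul_mx_diag; apply/matrixP => i j; rewrite !mxE.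
by case: eqP => [->|_]; rewrite ?mulr0n ?mulr1n; [ring | rewrite mulr0 mul0r subr0].
Qed.

Lemma spin_plus_minus :
  Sp *m Sm = (t%:R / 2%:R * (t%:R / 2%:R + 1))%:M - Z *m Z + Z.
Proof.
apply/matrixP => i j; rewrite spin_zE mul_diag_mx !mxE.
have [<-|nij] := eqVneq i j; last first.
  rewrite !mulr0n mulr0 subr0 addr0 big1 // => k _; rewrite !mxE.
  case: eqP => [->|_]; last by rewrite mulr0n mul0r.
  by rewrite eqSS val_eqE (negPf nij) mulr0n mulr0.
rewrite !mulr1n.
transitivity ((i.+1%:R * (t - i)%:R) : C); last first.
  by rewrite natrB -1?ltnS // -natr1; field.
(* In the last row, [i = t], there is no column [i.+1], in agreement with the factor [t - i], which
   is then zero. *)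
have [lti|] := ltnP i.+1 t.+1; last first.
  rewrite ltnS => le; rewrite (_ : t - i = 0)%N ?mulr0; last exact/eqP.
  rewrite big1 // => k _; rewrite !mxE (_ : t - i = 0)%N; last exact/eqP.
  by rewrite mulr0 sqrtC0 mul0rn mul0r.
rewrite (bigD1 (Ordinal lti)) //= big1 => [|k nk]; last first.
  by rewrite !mxE; move: nk; rewrite -val_eqE /= => /negPf->; rewrite mulr0n mul0r.
by rewrite !mxE eqxx mulr1n addr0 -expr2 sqrtCK.
Qed.

Lemma spin_minus_plus :
  Sm *m Sp = (t%:R / 2%:R * (t%:R / 2%:R + 1))%:M - Z *m Z - Z.
Proof.
apply/matrixP => i j; rewrite spin_zE mul_diag_mx !mxE.
have [<-|nij] := eqVneq i j; last first.
  rewrite !mulr0n mulr0 subr0 subr0 big1 // => k _; rewrite !mxE.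
  case: eqP => [ik|_]; last by rewrite mulr0n mul0r.
  by rewrite -ik eq_sym val_eqE (negPf nij) mulr0n mulr0.
rewrite !mulr1n.
case: i {j} => -[|i] /= lti.
  by rewrite big1 => [|k _]; rewrite ?mxE /= ?mulr0n ?mul0r //; field.
have lti' := ltnW lti.
rewrite (bigD1 (Ordinal lti')) //= big1 => [|k nk]; last first.
  rewrite !mxE /= eqSS eq_sym; move: nk; rewrite -val_eqE /= => /negPf->.
  by rewrite mulr0n mul0r.
rewrite !mxE eqxx mulr1n addr0 -expr2 sqrtCK natrB -1?ltnS //.
by rewrite -natr1; field.
Qed.

End Spin.

(** * Products of Lax operators *)

Section Transfer.
Variables (C : numClosedFieldType) (N : nat) (t : 'I_N -> nat).
Variables (eta : C) (xi : 'I_N -> C).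
Local Notation E := 'M[C]_(tdim t).
Local Notation Lx := (Lax t eta).

Let atZ n : E := at_site (spin_z C (t n)).
Let atP n : E := at_site (spin_plus C (t n)).
Let atM n : E := at_site (spin_minus C (t n)).

Let LaxE n lam : Lx n lam = lax eta (atZ n) (atP n) (atM n) lam.
Proof. by []. Qed.

Lemma at_site_scalar n (c : C) : at_site (c%:M : 'M[C]_((t n).+1)) = c%:M.
Proof. by rewrite -scalemx1 at_siteZ at_site1 scalemx1. Qed.

Lemma at_siteN n (O : 'M[C]_((t n).+1)) : at_site (- O) = - at_site O.
Proof. by rewrite -scaleN1r at_siteZ scaleN1r. Qed.

Lemma Lax_rtt n lam mu : rtt eta (lam - mu) (Lx n lam) (Lx n mu).
Proof.
rewrite !LaxE; apply: (@lax_rtt _ _ eta _ _ _ ((t n)%:R / 2%:R));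
  rewrite -!mulmxE -!at_siteM.
- by rewrite spin_z_plus at_siteD.
- by rewrite spin_z_minus at_siteD at_siteN.
- by rewrite spin_plus_minus !at_siteD at_siteN at_site_scalar.
- by rewrite spin_minus_plus !at_siteD !at_siteN at_site_scalar.
Qed.

Lemma Lax_qdet n lam : qdet (Lx n lam) (Lx n (lam - eta))
  ((lam + eta / 2%:R + (t n)%:R / 2%:R * eta) *
   (lam - eta / 2%:R - (t n)%:R / 2%:R * eta)).
Proof.
rewrite !LaxE; apply: (@lax_qdet _ _ eta _ _ _ ((t n)%:R / 2%:R));
  rewrite -!mulmxE -!at_siteM.
- by rewrite spin_z_plus at_siteD.
- by rewrite spin_z_minus at_siteD at_siteN.
- by rewrite spin_plus_minus !at_siteD at_siteN at_site_scalar.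
- by rewrite spin_minus_plus !at_siteD !at_siteN at_site_scalar.
Qed.

Lemma LaxEsite n lam i j :
  exists O : 'M[C]_((t n).+1), Lx n lam i j = at_site O.
Proof.
pose c : 'M[C]_((t n).+1) := (lam + eta / 2%:R)%:M.
elim/ord2P: i; elim/ord2P: j; rewrite mxE /=.
- exists (c + eta *: spin_z C (t n)).
  by rewrite at_siteD at_siteZ at_site_scalar.
- by exists (eta *: spin_minus C (t n)); rewrite at_siteZ.
- by exists (eta *: spin_plus C (t n)); rewrite at_siteZ.
- exists (c - eta *: spin_z C (t n)).
  by rewrite at_siteD at_siteN at_siteZ at_site_scalar.
Qed.

Lemma Lax_comm n n' lam mu : n != n' -> comm2 (Lx n lam) (Lx n' mu).
Proof.
move=> nn i j k l.
have [O ->] := LaxEsite n lam i j; have [O' ->] := LaxEsite n' mu k l.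
by rewrite -mulmxE at_site_comm.
Qed.

(** An arbitrary list of sites permits induction; [uniq r] then ensures that the factors commute. *)
Definition transfer (r : seq 'I_N) (lam : C) : 'M[E]_2 :=
  \prod_(n <- r) Lx n (lam - xi n).

Lemma transfer_cons n r lam :
  transfer (n :: r) lam = Lx n (lam - xi n) *m transfer r lam.
Proof. by rewrite /transfer big_cons. Qed.

Lemma transfer_comm n r lam mu : n \notin r -> comm2 (Lx n lam) (transfer r mu).
Proof.
elim: r => [_|n' r IH].
  rewrite /transfer big_nil => i j k l; rewrite [X in _ * X]mxE [X in _ = X * _]mxE.
  by case: (k == l); rewrite ?mulr1 ?mul1r ?mulr0 ?mul0r.
rewrite inE negb_or => /andP[nn nr]; rewrite transfer_cons.
by apply: comm2M; [apply: Lax_comm | apply: IH].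
Qed.

Let one2E : (1 : 'M[E]_2) = map_mx (fun c => c%:M : E) 1%:M.
Proof.
apply/matrixP => i j; rewrite !mxE; by case: eqP => _; rewrite ?mulr1n ?mulr0n ?raddf0.
Qed.

Lemma transfer_rtt r lam mu : uniq r ->
  rtt eta (lam - mu) (transfer r lam) (transfer r mu).
Proof.
elim: r => [_|n r IH /= /andP[nr ur]].
  by rewrite /transfer !big_nil one2E; apply: rtt_const.
rewrite !transfer_cons; apply: rttM.
- exact/comm2_sym/transfer_comm.
- exact/comm2_sym/transfer_comm.
- have -> : lam - mu = (lam - xi n) - (mu - xi n) by ring.
  exact: Lax_rtt.
- exact: IH.
Qed.

Lemma transfer_qdet r lam : uniq r ->
  qdet (transfer r lam) (transfer r (lam - eta))
    (\prod_(n <- r) ((lam - node t eta xi n (t n)) * (lam - eta - node t eta xi n 0))).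
Proof.
elim: r => [_|n r IH /= /andP[nr ur]].
  rewrite /transfer !big_nil.
  by move: (@qdet_const C (tdim t) 1%:M); rewrite det1 -one2E.
rewrite big_cons !transfer_cons; apply: qdetM; last exact: IH.
  exact/comm2_sym/transfer_comm.
rewrite addrAC; move: (Lax_qdet n (lam - xi n)); congr qdet.
by rewrite /node; field.
Qed.

Lemma Lax_polyfun n c : polyfun_mx 1 1%:M (fun lam => Lx n (lam - c)).
Proof.
move=> i j x y.
have p1 (z : C) (b : bool) :
    polyfun 1 b%:R (fun u => (u - c + eta / 2%:R) *+ b + z).
  apply: (polyfun_eq (polyfunD (polyfunM (polyfunX C) (polyfun_const b%:R))
    (polyfun_low (z - (c - eta / 2%:R) * b%:R) (ltn0Sn 0)))) => [|u].
    by rewrite mul1r addr0.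
  by case: b => /=; ring.
elim/ord2P: i; elim/ord2P: j; rewrite mxE /= ?mulr1n ?mulr0n.
- apply: (polyfun_eq (p1 (eta * atZ n x y) (x == y))) =>
    [|u]; by rewrite !mxE.
- apply: (polyfun_eq (polyfun_low (eta * atM n x y) (ltn0Sn 0))) =>
    [|u]; by rewrite !mxE.
- apply: (polyfun_eq (polyfun_low (eta * atP n x y) (ltn0Sn 0))) =>
    [|u]; by rewrite !mxE.
- apply: (polyfun_eq (p1 (- (eta * atZ n x y)) (x == y))) =>
    [|u]; by rewrite !mxE.
Qed.

Lemma transfer_polyfun r : polyfun_mx (size r) 1%:M (transfer r).
Proof.
elim: r => [|n r IH] i j x y.
  apply: (polyfun_eq (polyfun_const _) erefl) => u; by rewrite /transfer big_nil.
have := polyfun_mxM (Lax_polyfun n (xi n)) IH i j x y.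
rewrite mul1mx => p; apply: (polyfun_eq p erefl) => u.
by rewrite transfer_cons.
Qed.

(** As [bra0] is a product co-vector supported on index 0, only the first row of [O] contributes. *)
Lemma bra0_at_site n (O : 'M[C]_((t n).+1)) c :
  (forall k, O 0 k = c *+ (k == 0)) -> bra0 C t *m at_site O = c *: bra0 C t.
Proof.
move=> O0; apply/rowP => y; rewrite at_siteE !mxE.
under eq_bigr => x _ do rewrite !mxE -big_split.
rewrite -(prod_sum_mindex (fun m k => (k == ord0)%:R *
  dfwith (fun m => 1%:M : 'M[C]_((t m).+1)) O m k (label y m))).
have sumE (m : 'I_N) (f : 'I_(t m).+1 -> C) : \sum_k (k == ord0)%:R * f k = f ord0.
  rewrite (bigD1 ord0) //= mul1r big1 ?addr0 // => k /negPf->; exact: mul0r.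
under eq_bigr => m _ do rewrite sumE.
rewrite (bigD1 n) //= [in RHS](bigD1 n) //= dfwith_in O0 mulrA mulr_natr.
congr (_ * _); apply: eq_bigr => m nm.
by rewrite dfwith_out 1?(eq_sym n) // mxE eq_sym.
Qed.

Lemma bra0_Lax00 n lam : bra0 C t *m Lx n lam 0 0 =
  (lam + eta / 2%:R + (t n)%:R / 2%:R * eta) *: bra0 C t.
Proof.
rewrite mxE /= mulmxDr mul_mx_scalar -scalemxAr (@bra0_at_site _ _ ((t n)%:R / 2%:R)).
  by rewrite scalerA -scalerDl [eta * (_ * _)]mulrC.
by move=> k; rewrite mxE subr0 eq_sym.
Qed.

Lemma bra0_Lax11 n lam : bra0 C t *m Lx n lam 1 1 =
  (lam + eta / 2%:R - (t n)%:R / 2%:R * eta) *: bra0 C t.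
Proof.
rewrite mxE /= mulmxBr mul_mx_scalar -scalemxAr (@bra0_at_site _ _ ((t n)%:R / 2%:R)).
  by rewrite scalerA -scalerBl [eta * (_ * _)]mulrC.
by move=> k; rewrite mxE subr0 eq_sym.
Qed.

Lemma bra0_Lax01 n lam : bra0 C t *m Lx n lam 0 1 = 0.
Proof.
rewrite mxE /= -scalemxAr (@bra0_at_site _ _ 0) ?scale0r ?scaler0 //.
by move=> k; rewrite !mxE /= mulr0n mul0rn.
Qed.

Lemma bra0_transfer r lam : uniq r ->
  bra0 C t *m transfer r lam 0 1 = 0 /\
  bra0 C t *m transfer r lam 1 1 =
    \prod_(n <- r) (lam - node t eta xi n 0) *: bra0 C t.
Proof.
elim: r => [_|n r IH /= /andP[nr ur]].
  by rewrite /transfer !big_nil !mxE /= mulmx0 mulmx1 scale1r.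
have [IH0 IH1] := IH ur.
have sum2 (F : 'I_2 -> E) : \sum_a F a = F 0 + F 1.
  by rewrite !big_ord_recl big_ord0 addr0; congr (_ + F _); apply/val_inj.
have nd : lam - xi n + eta / 2%:R - (t n)%:R / 2%:R * eta = lam - node t eta xi n 0.
  by rewrite /node; ring.
rewrite transfer_cons !mxE !sum2 !mulmxDr -!mulmxE !mulmxA.
rewrite bra0_Lax00 bra0_Lax01 bra0_Lax11.
rewrite mul0mx addr0 -!scalemxAl IH0 scaler0; split=> //.
(* The [0 1] entry of the remaining sites is commuted to the left, where it annihilates [bra0]. *)
have cm : Lx n (lam - xi n) 1 0 *m transfer r lam 0 1 = _ :=
  transfer_comm (lam - xi n) lam nr 1 0 0 1.
rewrite -mulmxA cm -mulmxE mulmxA IH0 mul0mx add0r IH1.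
by rewrite scalerA nd big_cons.
Qed.

End Transfer.

(** * Interpolation and simultaneous eigenvectors *)

Section Interpolation.
Variable C : numClosedFieldType.

(** In characteristic 0, among [size s + n] distinct integers at least [n] avoid [s]: too many roots
    for a nonzero polynomial of size [n]. *)
Lemma poly_eq_cofinite (p q : {poly C}) (s : seq C) :
  (forall x, x \notin s -> p.[x] = q.[x]) -> p = q.
Proof.
move=> e; apply/eqP; rewrite -subr_eq0; apply/negPn/negP => pq0.
pose n := size (p - q).
pose r := [seq k%:R : C | k <- iota 0 (size s + n)].
have ur : uniq r.
  by rewrite map_inj_uniq ?iota_uniq // => k l /eqP; rewrite eqr_nat => /eqP.
pose r' := [seq y <- r | y \notin s].
have := max_poly_roots pq0 (rs := r').
rewrite filter_uniq // => /(_ _ isT) lt.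
have : (size r' < n)%N.
  apply: lt; apply/allP => y; rewrite mem_filter => /andP[ys _].
  by rewrite /root hornerD hornerN e // subrr.
apply/negP; rewrite -leqNgt.
have := count_predC (mem s) r; rewrite size_map size_iota size_filter.
have : (count (mem s) r <= size s)%N.
  rewrite -size_filter uniq_leq_size ?filter_uniq // => y.
  by rewrite mem_filter => /andP[].
by move=> le e'; rewrite -(leq_add2l (size s)) -e' leq_add2r.
Qed.

(** With only [N] nodes for degree [N], the leading coefficient is needed as well; its term vanishes
    at every node. *)
Lemma lagrange_interpolation N (x : 'I_N -> C) c g : injective x ->
  polyfun N c g -> forall u,
  g u = c * \prod_n (u - x n) +
    \sum_i (\prod_(j | j != i) ((u - x j) / (x i - x j))) * g (x i).
Proof.
move=> xI [p [gp sp cp]] u.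
pose l i : {poly C} := \prod_(j | j != i) ((x i - x j)^-1 *: ('X - (x j)%:P)).
pose q := c *: \prod_n ('X - (x n)%:P) + \sum_i g (x i) *: l i.
have lE i v : (l i).[v] = \prod_(j | j != i) ((v - x j) / (x i - x j)).
  by rewrite horner_prod; apply: eq_bigr => j _; rewrite hornerZ !hornerE mulrC.
have lx i j : (l i).[x j] = (i == j)%:R.
  rewrite lE; case: eqP => [<-|/eqP nij].
    by rewrite big1 // => k nk; rewrite divff // subr_eq0 (inj_eq xI) eq_sym.
  by rewrite (bigD1 j) 1?eq_sym //= subrr mul0r mul0r.
have sl i : (size (l i) <= N)%N.
  rewrite (leq_trans (size_poly_prod_leq _ _)) // leq_subLR.
  apply: (@leq_ltn_trans (\sum_(j < N | j != i) 2)%N).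
    by apply: leq_sum => j _; rewrite (leq_trans (size_scale_leq _ _)) // size_XsubC.
  rewrite sum_nat_const.
  have -> : #|(fun j : 'I_N => j != i)| = N.-1.
    by rewrite -[N in RHS]card_ord -(cardC1 i).
  have := ltn_ord i; lia.
suff -> : g u = q.[u].
  rewrite /q hornerD hornerZ horner_prod horner_sum; congr (_ * _ + _).
    by apply: eq_bigr => n _; rewrite !hornerE.
  by apply: eq_bigr => i _; rewrite hornerZ lE mulrC.
rewrite gp; congr _.[_]; apply/eqP; rewrite -subr_eq0.
have sw : size (\prod_n ('X - (x n)%:P)) = N.+1.
  by rewrite -(big_map x xpredT (fun a => 'X - a%:P)) size_prod_XsubC size_map
    -sum1_size big_const_ord iter_addn_0 mul1n.
have qN : q`_N = c.
  have := monic_prod_XsubC (index_enum 'I_N) xpredT x.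
  rewrite /q coefD coefZ monicE /lead_coef sw => /eqP ->.
  rewrite mulr1 coef_sum big1 ?addr0 // => i _.
  by rewrite coefZ nth_default ?mulr0 // sl.
apply/eqP; apply: (@roots_geq_poly_eq0 _ _ [seq x i | i <- enum 'I_N]).
- apply/allP => _ /mapP[i _ ->]; rewrite /root hornerD hornerN -gp subr_eq0.
  have p0 : \prod_(n < N) ('X - (x n)%:P).[x i] = 0.
    by rewrite (bigD1 i) //= hornerXsubC subrr mul0r.
  rewrite /q hornerD hornerZ horner_prod p0 mulr0 add0r.
  rewrite horner_sum (bigD1 i) //= hornerZ lx eqxx mulr1 big1 ?addr0 // => j nji.
  by rewrite hornerZ lx (negPf nji) mulr0.
- by rewrite map_inj_uniq ?enum_uniq.
(* The coefficients of degree [N] agree, so the difference has size at most [N] and its [N] roots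
   force it to vanish. *)
rewrite size_map size_enum_ord; apply/leq_sizeP => j.
rewrite coefB leq_eqVlt => /predU1P[<-|ltj]; first by rewrite cp qN subrr.
rewrite !nth_default ?subrr // ?(leq_trans sp) // (leq_trans (size_polyD _ _)) //.
rewrite geq_max (leq_trans (size_scale_leq _ _)) ?sw //.
apply: (leq_trans (size_sum _ _ _)); apply/bigmax_leqP => i _.
by rewrite (leq_trans (size_scale_leq _ _)) // (leq_trans (sl i)) // ltnW.
Qed.

End Interpolation.

(** * Bases of simultaneous eigen-co-vectors *)

Section SimultaneousEigenvectors.
Variables (C : fieldType) (m : nat) (I : finType).
Variables (v : I -> 'rV[C]_m) (T : Type) (B : T -> 'M[C]_m) (b : I -> T -> C).
Hypothesis eig : forall i u, v i *m B u = b i u *: v i.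
Hypothesis v_neq0 : forall i, v i != 0.
Hypothesis sep : forall i j, i != j -> exists u, b i u != b j u.

(** [X] is a product of factors [B u - b k u], one for each [k] in [s], with [u] chosen to separate
    [k] from [i]. *)
Lemma eigen_projector i (s : seq I) : i \notin s ->
  exists X (x : I -> C), [/\ forall j, v j *m X = x j *: v j, x i != 0 &
    forall j, j \in s -> x j = 0].
Proof.
elim: s => [_|k s IH].
  exists 1%:M, (fun=> 1); split=> // [j|]; rewrite ?mulmx1 ?scale1r //.
  exact: oner_neq0.
rewrite inE negb_or => /andP[nik /IH[X [x [vX xi0 xs]]]].
have [u nu] := sep nik.
exists (X *m (B u - (b k u)%:M)), (fun j => x j * (b j u - b k u)); split.
- move=> j; rewrite mulmxA vX -scalemxAl mulmxBr eig mul_mx_scalar -scalerBl.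
  by rewrite scalerA.
- by rewrite mulf_neq0 // subr_eq0.
- move=> j; rewrite inE => /predU1P[->|/xs->]; rewrite ?mul0r //.
  by rewrite subrr mulr0.
Qed.

Lemma eigen_indep (c : I -> C) : \sum_i c i *: v i = 0 -> forall i, c i = 0.
Proof.
move=> c0 i.
have [|X [x [vX xi0 xs]]] := @eigen_projector i [seq j <- enum I | j != i].
  by rewrite mem_filter eqxx.
have /eqP : (\sum_j c j *: v j) *m X = 0 by rewrite c0 mul0mx.
rewrite mulmx_suml (bigD1 i) //= big1 => [|j nji]; last first.
  by rewrite -scalemxAl vX xs ?scale0r ?scaler0 // mem_filter nji mem_enum.
rewrite addr0 -scalemxAl vX scalerA scaler_eq0 (negPf (v_neq0 i)) orbF.
by rewrite mulf_eq0 (negPf xi0) orbF => /eqP.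
Qed.

Hypothesis cardI : #|I| = m.

Lemma eigen_basis : basis_of fullv [seq v i | i : I].
Proof.
have -> : [seq v i | i : I] = tval (codom_tuple v) by [].
rewrite basisEfree subvf size_tuple dimvf dim_matrix mul1r.
have -> : (m <= #|I|)%N by rewrite cardI.
rewrite !andbT.
apply/freeP => k k0 i; rewrite -(enum_valK i).
apply: (eigen_indep (c := fun j => k (enum_rank j))).
rewrite -[RHS]k0 (reindex_onto enum_rank enum_val) => [|j _]; last exact: enum_valK.
apply: eq_big => [j|j _]; first by rewrite enum_rankK eqxx.
by rewrite nth_codom enum_rankK.
Qed.

Lemma eigen_span w : exists c : I -> C, w = \sum_i c i *: v i.
Proof.
have /andP[/eqP sp _] := eigen_basis.
have : w \in <<codom_tuple v>>%VS by rewrite sp memvf.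
move/coord_span->.
exists (fun j => coord (codom_tuple v) (enum_rank j) w).
rewrite (reindex_onto enum_rank enum_val) => [|j _]; last exact: enum_valK.
apply: eq_big => [j|j _]; first by rewrite enum_rankK eqxx.
by rewrite nth_codom enum_rankK.
Qed.

(** Expand [w] in the eigenbasis: by independence, each coefficient times [b i u - beta u] is
    zero. *)
Lemma eigen_outside (w : 'rV[C]_m) (beta : T -> C) :
  (forall u, w *m B u = beta u *: w) ->
  (forall i, exists u, b i u != beta u) -> w = 0.
Proof.
move=> ew sepw; have [c wE] := eigen_span w.
suff c0 i : c i = 0 by rewrite wE big1 // => i _; rewrite c0 scale0r.
have [u nu] := sepw i.
have /eigen_indep/(_ i)/eqP : \sum_i (c i * (b i u - beta u)) *: v i = 0.
  move: (ew u); rewrite {}wE mulmx_suml scaler_sumr => /eqP.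
  rewrite -subr_eq0 -sumrB => /eqP e; rewrite -[RHS]e; apply: eq_bigr => j _.
  by rewrite -scalemxAl eig !scalerA -scalerBl mulrBr [beta u * _]mulrC.
by rewrite mulf_eq0 subr_eq0 (negPf nu) orbF => /eqP.
Qed.

Lemma eigen_faithful n (Y : 'M[C]_(m, n)) : (forall i, v i *m Y = 0) -> Y = 0.
Proof.
move=> vY; apply/row_matrixP => k; rewrite row0 rowE.
have [c ->] := eigen_span (delta_mx 0 k).
by rewrite mulmx_suml big1 // => i _; rewrite -scalemxAl vY scaler0.
Qed.

End SimultaneousEigenvectors.

(** This serves to raise one index of a co-vector: the additional factor [z] at [i] commutes to the
    end. *)
Lemma prod_insert_comm (R : pzRingType) (I : eqType) (r : seq I) (F F' : I -> R) z i :
  uniq r -> i \in r -> (forall n, n != i -> F' n = F n) -> F' i = F i * z ->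
  (forall n, GRing.comm z (F n)) ->
  \prod_(n <- r) F' n = (\prod_(n <- r) F n) * z.
Proof.
move=> + + Fn Fi cz; elim: r => [|n r IH] //= /andP[nr ur].
rewrite !big_cons inE => /predU1P[e|ir].
  rewrite -e Fi -!mulrA; congr (_ * _).
  rewrite (eq_big_seq F) => [|k kr]; first exact: commr_prod.
  by rewrite Fn //; apply: contraNneq nr => ki; rewrite -e -ki.
by rewrite IH // mulrA Fn //; apply: contraNneq nr => ->.
Qed.

(** * Separation of variables *)

Section SoV.
Variables (C : numClosedFieldType) (N : nat) (t : 'I_N -> nat).
Variables (eta : C) (xi : 'I_N -> C).
Hypothesis eta_neq0 : eta != 0.
Hypothesis generic : generic_inhom t eta xi.
Variables (K : 'M[C]_2) (k1 k2 : C).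
Hypothesis detK : \det K = k1 * k2.
Hypothesis detK_neq0 : \det K != 0.
Hypothesis K01 : K 0 1 != 0.
Local Notation E := 'M[C]_(tdim t).
Local Notation node := (node t eta xi).
Local Notation a := (fun_a t eta xi).
Local Notation d := (fun_d t eta xi).
Local Notation A := (opA t eta xi K).
Local Notation B := (opB t eta xi K).
Local Notation X := (opC t eta xi K).
Local Notation D := (opD t eta xi K).
Local Notation M := (monodromy t eta xi K).
Local Notation Kmx := (map_mx (fun c => c%:M : E) K).

Let sites := [seq rev_ord n | n <- index_enum 'I_N].

Let uniq_sites : uniq sites.
Proof. by rewrite map_inj_uniq ?index_enum_uniq //; apply: rev_ord_inj. Qed.

Let big_sites (R : Type) (idx : R) (op : Monoid.com_law idx) F :
  \big[op/idx]_(n <- sites) F n = \big[op/idx]_(n < N) F n.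
Proof. by rewrite big_map [RHS](reindex_inj rev_ord_inj). Qed.

Let monodromyE lam : M lam = Kmx *m transfer t eta xi sites lam.
Proof. by rewrite /transfer big_map. Qed.

(** * Relations between the entries of the monodromy matrix *)

Lemma monodromy_rtt lam mu : rtt eta (lam - mu) (M lam) (M mu).
Proof.
rewrite !monodromyE; apply: rttM.
- exact/comm2_sym/comm2_const.
- exact/comm2_sym/comm2_const.
- exact: rtt_const.
- exact: transfer_rtt.
Qed.

Lemma monodromy_qdet lam :
  A lam *m D (lam - eta) - B lam *m X (lam - eta) =
  (k1 * k2 * a lam * d (lam - eta))%:M.
Proof.
have q := qdetM (comm2_sym (comm2_const K _)) (@qdet_const C (tdim t) K)
  (@transfer_qdet _ _ t eta xi sites lam uniq_sites).
have := q 0 1; rewrite -!monodromyE /= subr0 mulr1 detK big_sites big_split mulrA.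
exact.
Qed.

Lemma monodromy_polyfun i j x y :
  polyfun N (K i j *+ (x == y)) (fun lam => M lam i j x y).
Proof.
have pK : polyfun_mx 0 Kmx (fun=> Kmx) by move=> *; apply: polyfun_const.
have := polyfun_mxM pK (transfer_polyfun eta xi sites) i j x y.
rewrite mulmx1 add0n size_map -sum1_size big_const_ord iter_addn_0 mul1n.
by move/polyfun_eq; apply=> [|u]; [rewrite !mxE | rewrite monodromyE].
Qed.

Lemma bra0_opB lam : bra0 C t *m B lam = (K 0 1 * d lam) *: bra0 C t.
Proof.
have [b0 b1] := @bra0_transfer _ _ t eta xi sites lam uniq_sites.
rewrite /opB monodromyE mxE !big_ord_recl big_ord0 addr0 !mxE.
have -> : lift ord0 ord0 = 1 :> 'I_2 by apply/val_inj.
rewrite mulmxDr -!mulmxE !mul_scalar_mx -!scalemxAr b0 scaler0 add0r b1.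
by rewrite scalerA big_sites.
Qed.

(** The exchange relation gives commutation up to the factor [u - v + eta]. The factors for
    [(lam, mu)] and [(mu, lam)] add up to [2 eta], so one of them is nonzero. *)
Lemma opA_comm lam mu : A lam *m A mu = A mu *m A lam.
Proof.
have main u v : u - v + eta != 0 -> A u *m A v = A v *m A u.
  move=> uv0; have := monodromy_rtt u v 0 0 0 0.
  by rewrite -!scalerDl => /(scalerI uv0).
have [e0|] := eqVneq (lam - mu + eta) 0; last exact: main.
apply/esym/main; apply: contra_neq eta_neq0 => e1.
have /eqP : eta *+ 2 = (lam - mu + eta) + (mu - lam + eta) by ring.
by rewrite e0 e1 addr0 mulrn_eq0 /= => /eqP.
Qed.

(** In this arrangement the last term starts with [B lam], and so vanishes on an eigen-co-vector
    whose eigenvalue is zero at [lam]. *)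
Lemma opA_opB_exchange lam mu :
  (mu - lam) *: (A lam *m B mu) =
  (mu - lam + eta) *: (B mu *m A lam) - eta *: (B lam *m A mu).
Proof.
have := monodromy_rtt mu lam 0 1 0 0.
by rewrite -!mulmxE -scalerDl => ->; rewrite addrK.
Qed.

Lemma opD_opB_exchange lam mu :
  (mu - lam) *: (D lam *m B mu) =
  (mu - lam - eta) *: (B mu *m D lam) + eta *: (B lam *m D mu).
Proof.
have := monodromy_rtt lam mu 1 1 0 1.
rewrite -!mulmxE -scalerDl => /(canRL (addrK _)) e.
have -> : mu - lam = - (lam - mu) by ring.
by rewrite -[- _ - eta]opprD !scaleNr [X in - X]e opprB addrC.
Qed.

(** * Separation of the nodes *)

Lemma node_inj i k l : node i k = node i l -> k = l.
Proof.
move=> e; apply/eqP; rewrite -(eqr_nat C) -subr_eq0.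
rewrite -(mulIr_eq0 _ (mulIf eta_neq0)).
have -> : (k%:R - l%:R) * eta = node i l - node i k by rewrite /Defs.node; ring.
by rewrite e subrr.
Qed.

Lemma node_neq i j k l : i != j -> (k <= t i)%N -> (l <= t j)%N ->
  node i k != node j l.
Proof.
have [g1 g2] := generic => nij kt lt.
have [e|ne] := eqVneq (odd (t i)) (odd (t j)); last exact: g2.
(* Equal nodes would make [xi i - xi j] this multiple of [eta]; it is an integer multiple because
   the equal parities of [t i] and [t j] cancel. *)
apply: contra (g1 _ _ nij ((t j)./2%:Z - (t i)./2%:Z + k%:Z - l%:Z)) => /eqP en.
have half n : n%:R = (odd n)%:R + n./2%:R * 2%:R :> C.
  by rewrite -[in LHS](odd_double_half n) natrD -muln2 natrM.
have -> : xi i - xi j = node i k - node j l +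
    ((t j)%:R / 2%:R - (t i)%:R / 2%:R + k%:R - l%:R) * eta.
  by rewrite /Defs.node; ring.
rewrite en subrr add0r (half (t i)) (half (t j)) e.
rewrite rmorphB /= rmorphD /= rmorphB /= -!pmulrn.
by apply/eqP; field.
Qed.

Lemma fun_a_neq0 i k : (k < t i)%N -> a (node i k) != 0.
Proof.
move=> kt; apply/prodf_neq0 => n _; rewrite subr_eq0.
have [<-|nin] := eqVneq i n; last by rewrite node_neq // ltnW.
by apply: contraTneq kt => /node_inj ->; rewrite ltnn.
Qed.

Lemma fun_d_neq0 i k : (0 < k)%N -> (k <= t i)%N -> d (node i k) != 0.
Proof.
move=> k0 kt; apply/prodf_neq0 => n _; rewrite subr_eq0.
have [<-|nin] := eqVneq i n; last by rewrite node_neq.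
by apply: contraTneq k0 => /node_inj ->.
Qed.

Lemma fun_a_last i : a (node i (t i)) = 0.
Proof. by rewrite /fun_a (bigD1 i) //= subrr mul0r. Qed.

Lemma fun_d_first i : d (node i 0) = 0.
Proof. by rewrite /fun_d (bigD1 i) //= subrr mul0r. Qed.

Lemma node_step i k : node i k.+1 = node i k - eta.
Proof. by rewrite /Defs.node -natr1; ring. Qed.

Lemma k1_neq0 : k1 != 0.
Proof. by move: detK_neq0; rewrite detK mulf_eq0 negb_or => /andP[]. Qed.

Lemma k2_neq0 : k2 != 0.
Proof. by move: detK_neq0; rewrite detK mulf_eq0 negb_or => /andP[]. Qed.

(* The co-vectors of [covec], indexed by arbitrary natural numbers so that
   single indices can be incremented. *)
Definition ncovec (h : 'I_N -> nat) : 'rV[C]_(tdim t) :=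
  bra0 C t *m \prod_(n < N) \prod_(k < h n)
         ((k1 * a (node n k))^-1 *: A (node n k)).

Definition incr (h : 'I_N -> nat) i n := (h n + (n == i))%N.

Lemma eq_ncovec h h' : h =1 h' -> ncovec h = ncovec h'.
Proof. by move=> e; congr (_ *m _); apply: eq_bigr => n _; rewrite e. Qed.

Lemma ncovec_incr h i : ncovec (incr h i) =
  (k1 * a (node i (h i)))^-1 *: (ncovec h *m A (node i (h i))).
Proof.
rewrite scalemxAr /ncovec -mulmxA; congr (_ *m _).
have cA c c' u v : GRing.comm (c *: A u : E) (c' *: A v).
  rewrite /GRing.comm -!mulmxE -!scalemxAl -!scalemxAr.
  by rewrite opA_comm scalerA mulrC -scalerA.
apply: (prod_insert_comm (i := i)).
- exact: index_enum_uniq.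
- exact: mem_index_enum.
- by move=> n /negPf ni; rewrite /incr ni addn0.
- by rewrite /incr eqxx addn1 big_ord_recr.
- by move=> n; apply: commr_prod => k _; apply: cA.
Qed.

(** * Eigen-co-vectors of B *)

Definition bpoly (h : 'I_N -> nat) lam := K 0 1 * \prod_(n < N) (lam - node n (h n)).

(** Common argument for [A] and [D], where [xi'] is the new place of the zero. The last term of the
    exchange relation vanishes on [v]; dividing by [lam - node i (h i)] gives the claim off this
    node, and polynomiality in [lam] extends it. *)
Lemma eigen_shift (v : 'rV[C]_(tdim t)) (Y : E) (Z : C -> E) (h : 'I_N -> nat) i xi' e :
  (forall lam, v *m B lam = bpoly h lam *: v) ->
  (forall lam, (lam - node i (h i)) *: (Y *m B lam) =
     (lam - xi') *: (B lam *m Y) + e *: (B (node i (h i)) *m Z lam)) ->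
  forall lam, (v *m Y) *m B lam =
    (K 0 1 * ((lam - xi') * \prod_(n < N | n != i) (lam - node n (h n)))) *: (v *m Y).
Proof.
move=> ev exch lam; apply/rowP => y.
have [pB pBE] : exists p : {poly C}, forall u, ((v *m Y) *m B u) 0 y = p.[u].
  have [p [pE _ _]] : polyfun N
      (\sum_x (v *m Y) 0 x * (K 0 1 *+ (x == y))) (fun u => ((v *m Y) *m B u) 0 y).
    apply: (polyfun_eq _ erefl (fun u => esym (mxE _ _ _ _))).
    apply: polyfun_sum => x.
    by apply: (@polyfunM _ 0 N); [apply: polyfun_const | apply: monodromy_polyfun].
  by exists p.
pose q : {poly C} := (K 0 1 * (v *m Y) 0 y) *:
  (('X - xi'%:P) * \prod_(n < N | n != i) ('X - (node n (h n))%:P)).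
have qE u : q.[u] =
    ((K 0 1 * ((u - xi') * \prod_(n < N | n != i) (u - node n (h n)))) *: (v *m Y)) 0 y.
  rewrite hornerZ hornerM hornerXsubC horner_prod [RHS]mxE mulrAC.
  congr (_ * (_ * _) * _).
  by apply: eq_bigr => n _; rewrite hornerXsubC.
rewrite pBE -qE; congr _.[_]; apply: (@poly_eq_cofinite _ _ _ [:: node i (h i)]) => u.
rewrite inE => nu; rewrite -pBE qE; congr (fun_of_matrix _ _ _).
have u0 : u - node i (h i) != 0 by rewrite subr_eq0.
apply: (scalerI u0).
rewrite -mulmxA scalemxAr exch mulmxDr -!scalemxAr !mulmxA !ev -!scalemxAl.
have -> : bpoly h (node i (h i)) = 0.
  by rewrite /bpoly (bigD1 i) //= subrr mul0r mulr0.
rewrite scale0r scaler0 addr0 !scalerA; congr (_ *: _).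
by rewrite /bpoly (bigD1 i) //=; ring.
Qed.

Lemma eigen_opA (v : 'rV[C]_(tdim t)) (h : 'I_N -> nat) i :
  (forall lam, v *m B lam = bpoly h lam *: v) ->
  forall lam, (v *m A (node i (h i))) *m B lam =
    bpoly (incr h i) lam *: (v *m A (node i (h i))).
Proof.
move=> ev lam.
rewrite (@eigen_shift v _ A h i (node i (h i).+1) (- eta) ev) => [|u].
  congr (_ *: _); congr (_ * _); rewrite [RHS](bigD1 i) //= /incr eqxx addn1.
  by congr (_ * _); apply: eq_bigr => n /negPf->; rewrite addn0.
by rewrite opA_opB_exchange node_step scaleNr; congr (_ *: _ - _); ring.
Qed.

(** The new zero is written [node i (h i) + eta], since at [h i = 0] no natural number indexes
    it. *)
Lemma eigen_opD (v : 'rV[C]_(tdim t)) (h : 'I_N -> nat) i :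
  (forall lam, v *m B lam = bpoly h lam *: v) ->
  forall lam, (v *m D (node i (h i))) *m B lam =
    (K 0 1 * ((lam - (node i (h i) + eta)) *
      \prod_(n < N | n != i) (lam - node n (h n)))) *: (v *m D (node i (h i))).
Proof.
move=> ev lam; apply: (@eigen_shift v _ D h i _ eta ev) => u.
by rewrite opD_opB_exchange; congr (_ *: _ + _); ring.
Qed.

Lemma ncovec_eigen h : (forall n, h n <= t n)%N ->
  (forall lam, ncovec h *m B lam = bpoly h lam *: ncovec h) /\ ncovec h != 0.
Proof.
have [s] := ubnP (\sum_n h n)%N; elim: s h => [//|s IH] h; rewrite ltnS => hs ht.
have [i hi0|h0] := pickP (fun i => 0 < h i)%N; last first.
  have hE : h =1 (fun=> 0%N) by move=> n; apply/eqP; move: (h0 n); case: (h n).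
  have -> : ncovec h = bra0 C t.
    by rewrite (eq_ncovec hE) /ncovec big1 ?mulmx1 // => n _; rewrite big_ord0.
  split=> [lam|].
    by rewrite bra0_opB /bpoly; under [in RHS]eq_bigr => n _ do rewrite hE.
  apply/eqP => /rowP/(_ (enum_rank ([ffun=> ord0] : mindex t))).
  rewrite !mxE big1 => [/eqP|n _]; first by rewrite oner_eq0.
  by rewrite /label enum_rankK ffunE eqxx.
pose g n := (h n - (n == i))%N.
have hE : h =1 incr g i by move=> n; rewrite /incr /g; case: eqP => [->|_]; lia.
have gt n : (g n <= t n)%N by rewrite (leq_trans _ (ht n)) ?leq_subr.
have gs : (\sum_n g n < s)%N.
  apply: leq_trans hs; rewrite (bigD1 i) //= [X in (_ < X)%N](bigD1 i) //=.
  rewrite -addSn leq_add //; first by rewrite /g eqxx; lia.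
  by apply: leq_sum => n _; apply: leq_subr.
have [eg g0] := IH g gs gt.
have gti : (g i < t i)%N by have := ht i; rewrite hE /incr eqxx addn1.
have a0 : k1 * a (node i (g i)) != 0 by rewrite mulf_neq0 ?k1_neq0 ?fun_a_neq0.
rewrite (eq_ncovec hE) ncovec_incr; split=> [lam|].
  rewrite -scalemxAl eigen_opA // scalerA mulrC -scalerA; congr (_ *: _).
  by rewrite /bpoly; under [in RHS]eq_bigr => n _ do rewrite hE.
(* Were the raised co-vector zero, the quantum determinant applied to [ncovec g], whose [B] term
   vanishes at this node, would give a nonzero scalar times [ncovec g] equal to zero. *)
rewrite scaler_eq0 invr_eq0 negb_or a0 /=; apply: contraNneq g0 => gA0.
have := congr1 (mulmx (ncovec g)) (monodromy_qdet (node i (g i))).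
rewrite mulmxBr !mulmxA gA0 eg mul0mx mul_mx_scalar.
rewrite /bpoly (bigD1 i) //= subrr mul0r mulr0 scale0r mul0mx subrr => /esym/eqP.
rewrite scaler_eq0 => /orP[|//].
rewrite -node_step !mulf_eq0 (negPf k1_neq0) (negPf k2_neq0).
by rewrite (negPf (fun_a_neq0 gti)) (negPf (fun_d_neq0 (ltn0Sn _) gti)).
Qed.

Local Notation Sk := (covec eta xi (bra0 C t) A k1).
Implicit Types h : mindex t.

Let hle h n : (h n <= t n)%N.
Proof. by rewrite -ltnS ltn_ord. Qed.

Lemma covec_eigen h lam : Sk h *m B lam = bpoly (fun n => h n) lam *: Sk h.
Proof. by have [+ _] := @ncovec_eigen (fun n => h n) (hle h); apply. Qed.

Lemma covec_neq0 h : Sk h != 0.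
Proof. by have [_ +] := @ncovec_eigen (fun n => h n) (hle h). Qed.

(** Where [h] and [h'] differ, the node of [h] is a zero of the first eigenvalue and not of the
    second. *)
Lemma bpoly_sep h h' : h != h' ->
  exists lam, bpoly (fun n => h n) lam != bpoly (fun n => h' n) lam.
Proof.
move=> nh.
have [n nn] : exists n, h n != h' n.
  apply/existsP; rewrite -negb_forall; apply: contra nh => /forallP e.
  by apply/eqP/ffunP => n; apply/eqP.
exists (node n (h n)); rewrite {1}/bpoly (bigD1 n) //= subrr mul0r mulr0 eq_sym.
rewrite mulf_neq0 //; apply/prodf_neq0 => m _; rewrite subr_eq0.
have [<-|nm] := eqVneq n m; last exact: node_neq.
by apply: contra nn => /eqP/node_inj/val_inj->.
Qed.

Lemma card_mindex : #|{: mindex t}| = tdim t.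
Proof. by []. Qed.

Lemma covec_is_basis : covec_basis Sk.
Proof. exact: (eigen_basis covec_eigen covec_neq0 bpoly_sep card_mindex). Qed.

(** The product would have an eigenvalue with a zero at [node i (t i).+1], outside the spectrum
    described by [mindex]. *)
Lemma covec_opA_last h i : h i = t i :> nat -> Sk h *m A (node i (h i)) = 0.
Proof.
move=> hi; apply: (eigen_outside covec_eigen covec_neq0 bpoly_sep card_mindex).
  exact: (@eigen_opA _ (fun n => h n) i (covec_eigen h)).
(* This point is a zero of the eigenvalue of [h'], but not of the shifted one, as [h' i <= t i]. *)
move=> h'; exists (node i (h' i)).
rewrite {1}/bpoly (bigD1 i) //= subrr mul0r mulr0 eq_sym mulf_neq0 //.
apply/prodf_neq0 => n _; rewrite subr_eq0 /incr.
have [->|nin] := eqVneq n i; last by rewrite addn0 node_neq // eq_sym.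
apply/negP => /eqP/node_inj e; have := hle h' i; rewrite e hi; lia.
Qed.

(** Here the zero would move to [node i 0 + eta]; it could meet [node i (h' i)] only if
    [(h' i).+1 * eta] were zero. *)
Lemma covec_opD_first h i : h i = 0%N :> nat -> Sk h *m D (node i (h i)) = 0.
Proof.
move=> hi; apply: (eigen_outside covec_eigen covec_neq0 bpoly_sep card_mindex).
  exact: (@eigen_opD _ (fun n => h n) i (covec_eigen h)).
move=> h'; exists (node i (h' i)).
rewrite {1}/bpoly (bigD1 i) //= subrr mul0r mulr0 eq_sym !mulf_neq0 //.
  rewrite hi subr_eq0; apply: contraNneq eta_neq0 => e.
  have /eqP : (h' i).+1%:R * eta = 0.
    rewrite -[RHS](subrr (node i (h' i))) [X in _ = X - _]e /Defs.node -natr1; ring.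
  by rewrite mulf_eq0 pnatr_eq0 => /=.
by apply/prodf_neq0 => n nin; rewrite subr_eq0 node_neq // eq_sym.
Qed.

(** * Actions of A and D on the basis *)

Lemma shift_covec h (g : 'I_N -> nat) i e : (forall n, g n <= t n)%N ->
  (forall n, (g n)%:Z = (h n)%:Z + (if n == i then e else 0)) ->
  shift_bra Sk i e h = ncovec g.
Proof.
move=> gt gE; rewrite /shift_bra /ext_bra; case: pickP => [x /forallP xP|no].
  by apply: eq_ncovec => n; apply/eqP; rewrite -eqz_nat gE; apply: xP.
have := no [ffun n => inord (g n)]; case/negP; apply/forallP => n.
by rewrite ffunE inordK ?ltnS // gE.
Qed.

(** Inside the range this is the normalization of the co-vectors; at [h i = t i] both sides vanish,
    the right one through [fun_a]. *)
Lemma covec_opA_node h i :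
  Sk h *m A (node i (h i)) = (k1 * a (node i (h i))) *: shift_bra Sk i 1 h.
Proof.
have := hle h i; rewrite leq_eqVlt => /predU1P[hi|hi].
  by rewrite covec_opA_last // hi fun_a_last mulr0 scale0r.
rewrite (@shift_covec h (incr (fun n => h n) i)) => [|n|n].
- by rewrite ncovec_incr scalerA divff ?scale1r // mulf_neq0 ?k1_neq0 ?fun_a_neq0.
- by rewrite /incr; case: eqP => [->|_]; rewrite ?addn1 ?addn0.
- by rewrite /incr PoszD; case: eqP.
Qed.

(** For [h i > 0], write the co-vector as a step by [A] from the lowered index [g]. The quantum
    determinant at [node i (g i)] evaluates [A] followed by [D], since its [B] term vanishes on
    [ncovec g]. *)
Lemma covec_opD_node h i :
  Sk h *m D (node i (h i)) = (k2 * d (node i (h i))) *: shift_bra Sk i (-1) h.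
Proof.
have [hi|hi] := posnP (h i).
  by rewrite covec_opD_first // hi fun_d_first mulr0 scale0r.
pose g n := (h n - (n == i))%N.
have hE : (fun n => nat_of_ord (h n)) =1 incr g i.
  by move=> n; rewrite /incr /g; case: eqP => [->|_]; lia.
have gt n : (g n <= t n)%N by rewrite (leq_trans _ (hle h n)) ?leq_subr.
have hg : h i = (g i).+1 :> nat by rewrite [LHS]hE /incr eqxx addn1.
have gti : (g i < t i)%N by rewrite -hg.
have a0 : k1 * a (node i (g i)) != 0 by rewrite mulf_neq0 ?k1_neq0 ?fun_a_neq0.
rewrite (@shift_covec h g) => [|//|n]; last first.
  by rewrite [in RHS]hE /incr PoszD; case: eqP => /= _; lia.
have -> : Sk h = ncovec (incr g i) by apply: eq_ncovec.
rewrite ncovec_incr hg node_step -scalemxAl.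
apply: (scalerI a0); rewrite !scalerA divff // scale1r.
have [eg _] := ncovec_eigen gt.
have := congr1 (mulmx (ncovec g)) (monodromy_qdet (node i (g i))).
rewrite mulmxBr !mulmxA eg mul_mx_scalar.
rewrite {1}/bpoly (bigD1 i) //= subrr mul0r mulr0 scale0r mul0mx subr0 => ->.
by congr (_ *: _); ring.
Qed.

Lemma covec_interp (Y : C -> E) (c : C) w e :
  (forall x y, polyfun N (c *+ (x == y)) (fun lam => Y lam x y)) ->
  (forall h i, Sk h *m Y (node i (h i)) = w (node i (h i)) *: shift_bra Sk i e h) ->
  forall h lam, Sk h *m Y lam = interp_action eta xi Sk c w e h lam.
Proof.
move=> pY Yn h lam; apply/rowP => y.
have xI : injective (fun i => node i (h i)).
  by move=> i j /eqP; apply: contraTeq => nij; apply: node_neq.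
(* The leading coefficient of [Y] is [c] times the identity, hence that of the coordinate is
   [c * Sk h 0 y]. *)
have pg : polyfun N (c * Sk h 0 y) (fun u => (Sk h *m Y u) 0 y).
  have : polyfun N (\sum_x Sk h 0 x * (c *+ (x == y))) (fun u => (Sk h *m Y u) 0 y).
    apply: (polyfun_eq _ erefl (fun u => esym (mxE _ _ _ _))).
    apply: polyfun_sum => x.
    by apply: (@polyfunM _ 0 N); [apply: polyfun_const | apply: pY].
  move/polyfun_eq; apply=> //; rewrite (bigD1 y) //= eqxx mulr1n big1 ?addr0 1?mulrC //.
  by move=> x /negPf->; rewrite mulr0n mulr0.
rewrite (lagrange_interpolation xI pg lam) /interp_action.
rewrite [in RHS]mxE [in RHS]mxE summxE.
congr (_ + _); first by rewrite mulrAC.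
by apply: eq_bigr => i _; rewrite Yn !mxE mulrA.
Qed.

Lemma covec_opA h lam :
  Sk h *m A lam = interp_action eta xi Sk (K 0 0) (fun x => k1 * a x) 1 h lam.
Proof.
by apply: covec_interp => [x y|]; [apply: monodromy_polyfun | apply: covec_opA_node].
Qed.

Lemma covec_opD h lam :
  Sk h *m D lam = interp_action eta xi Sk (K 1 1) (fun x => k2 * d x) (-1) h lam.
Proof.
by apply: covec_interp => [x y|]; [apply: monodromy_polyfun | apply: covec_opD_node].
Qed.

(** Where no eigenvalue of [B (u + eta)] vanishes, the relation determines the last operator at [u];
    polynomiality covers the finitely many other points. *)
Lemma opC_unique (Y : 'M[{poly C}]_(tdim t)) :
  qdet_rel eta xi k1 k2 A B (poly_op Y) D -> poly_op Y =1 X.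
Proof.
move=> qY lam; apply/matrixP => x y.
have [p [pE _ _]] := monodromy_polyfun 1 0 x y.
rewrite mxE /opC pE; congr _.[_].
(* The points [u] for which [u + eta] is a node. *)
pose s := [seq node n k - eta | n <- enum 'I_N, k <- iota 0 (t n).+1].
apply: (@poly_eq_cofinite _ _ _ s) => u us; rewrite -pE.
suff : poly_op Y u - X u = 0 by move/subr0_eq/matrixP/(_ x y); rewrite mxE.
apply: (eigen_faithful covec_eigen covec_neq0 bpoly_sep card_mindex) => h.
have := qY (u + eta); rewrite -monodromy_qdet addrK => /addrI/oppr_inj qE.
have b0 : bpoly (fun n => h n) (u + eta) != 0.
  rewrite mulf_neq0 //; apply/prodf_neq0 => n _; rewrite subr_eq0.
  apply: contraNneq us => e; apply/allpairsPdep; exists n, (h n : nat).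
  by rewrite mem_enum mem_iota /= ltn_ord -e addrK.
apply: (scalerI b0); rewrite scaler0 scalemxAl -covec_eigen -mulmxA mulmxBr qE.
by rewrite subrr mulmx0.
Qed.

End SoV.

(** * Symmetric powers and conjugation *)

Section SymmetricPower.
Variables (C : numClosedFieldType) (t : nat).
Local Notation bits := (fun _ : 'I_t => 1%N).
Local Notation S := (sym_basis C t).

Let wt (x : 'I_(tdim bits)) := #|[set n : 'I_t | label x n != ord0]|.

Let wt_le x : (wt x < t.+1)%N.
Proof. by rewrite ltnS (leq_trans (max_card _)) ?card_ord. Qed.

(** A generating function in which ['X] marks the tensor factors carrying the second basis
    vector. *)
Lemma sum_by_weight (F : 'I_t -> 'I_2 -> C) j :
  \sum_(y | wt y == j) \prod_n F n (label y n) =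
  (\prod_n ((F n 0)%:P + (F n 1)%:P * 'X))`_j.
Proof.
have ord2sum (G : 'I_2 -> {poly C}) : \sum_k G k = G 0 + G 1.
  by rewrite !big_ord_recl big_ord0 addr0; congr (_ + G _); apply/val_inj.
transitivity ((\prod_n \sum_(k < 2) (F n k)%:P * 'X^(k != ord0))`_j); last first.
  rewrite (eq_bigr (fun n => (F n 0)%:P + (F n 1)%:P * 'X)) // => n _.
  by rewrite ord2sum mulr1.
rewrite (@prod_sum_mindex _ t bits (fun n k => (F n k)%:P * 'X^(k != ord0))).
rewrite coef_sum big_mkcond; apply: eq_bigr => y _ /=.
rewrite big_split /= -rmorph_prod prodrXr coefCM coefXn.
rewrite (_ : (\sum_n _)%N = wt y) ?[j == _]eq_sym; last first.
  by rewrite /wt -sum1dep_card [RHS]big_mkcond; apply: eq_bigr => n _; case: eqP.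
by case: eqP => _; rewrite ?mulr1 ?mulr0.
Qed.

Let nu j : C := (sqrtC 'C(t, j)%:R)^-1.

Let nu_neq0 (j : 'I_t.+1) : nu j != 0.
Proof. by rewrite invr_eq0 sqrtC_eq0 pnatr_eq0 -lt0n bin_gt0 -ltnS. Qed.

Let SE x j : S x j = nu j *+ (wt x == j).
Proof. by rewrite mxE. Qed.

Lemma sym_basis_orthonormal : S^T *m S = 1%:M.
Proof.
apply/matrixP => i j; rewrite !mxE.
under eq_bigr => x _ do rewrite mxE !SE.
have [<-|nij] := eqVneq i j; last first.
  rewrite mulr0n big1 // => x _; case: eqP => [->|_]; last by rewrite mulr0n mul0r.
  by rewrite val_eqE (negPf nij) mulr0n mulr0.
transitivity (\sum_(x | wt x == i) nu i * nu i).
  rewrite [RHS]big_mkcond; apply: eq_bigr => x _.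
  by case: eqP; rewrite ?mulr1n ?mulr0n ?mulr0.
(* The multi-indices of weight [i] are counted by the coefficient of degree [i] in [(1 + 'X)^t]. *)
have s1 : \sum_(x | wt x == i) 1 = 'C(t, i)%:R :> C.
  transitivity (\sum_(x | wt x == i) \prod_(n < t) (1 : C)).
    by apply: eq_bigr => x _; rewrite big1_eq.
  rewrite (sum_by_weight (fun _ _ => 1) i) prodr_const card_ord mul1r addrC exprD1n.
  rewrite coef_sum (bigD1 i) //= big1 ?addr0 => [|k nki]; last first.
    by rewrite coefMn coefXn eq_sym val_eqE (negPf nki) mul0rn.
  by rewrite coefMn coefXn eqxx.
under eq_bigr => x _ do rewrite -[_ * _]mulr1.
rewrite -mulr_sumr s1 -invfM -expr2 sqrtCK mulVf //.
by rewrite pnatr_eq0 -lt0n bin_gt0 -ltnS.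
Qed.

(* The rows of [W^{(x) t} *m S] only depend on the weight of their index, so
   the columns of [S] span a stable subspace. *)
Lemma sym_basis_stable (W : 'M[C]_2) :
  exists M, tens_mx (fun _ : 'I_t => W) *m S = S *m M.
Proof.
(* [q a] is the generating polynomial of row [a] of [W]; a row index of weight [i] uses [q 1] for
   [i] factors and [q 0] for the others. *)
pose q a := (W a 0)%:P + (W a 1)%:P * 'X.
pose f i j := (q 1 ^+ i * q 0 ^+ (t - i))`_j * nu j.
exists (\matrix_(i, j) ((nu i)^-1 * f i j)).
apply/matrixP => x j; rewrite !mxE.
transitivity (f (wt x) j); last first.
  rewrite (bigD1 (Ordinal (wt_le x))) //= big1 ?addr0 => [|i ni].
    by rewrite SE !mxE eqxx mulr1n mulVKf // (nu_neq0 (Ordinal (wt_le x))).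
  by rewrite SE; move: ni; rewrite -val_eqE eq_sym /= => /negPf->; rewrite mulr0n mul0r.
transitivity (\sum_(y | wt y == j) \prod_n W (label x n) (label y n) * nu j).
  rewrite [RHS]big_mkcond; apply: eq_bigr => y _; rewrite SE mxE.
  by case: eqP => _; rewrite ?mulr1n ?mulr0n ?mulr0.
have qE n : (W (label x n) 0)%:P + (W (label x n) 1)%:P * 'X =
    if n \in [set n | label x n != ord0] then q 1 else q 0.
  by rewrite inE; move: (label x n); apply: ord2P.
rewrite -mulr_suml (sum_by_weight (fun n k => W (label x n) k)) /f.
under eq_bigr => n _ do rewrite qE.
suff -> (T : {set 'I_t}) : \prod_n (if n \in T then q 1 else q 0) =
  q 1 ^+ #|T| * q 0 ^+ (t - #|T|) by [].
rewrite (bigID (mem T)) /=; congr (_ * _).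
  by rewrite (eq_bigr (fun=> q 1)) ?prodr_const // => n ->.
rewrite (eq_bigr (fun=> q 0)) => [|n /negPf->//]; rewrite prodr_const.
by congr (_ ^+ _); rewrite -[X in (X - _)%N]card_ord -(cardC (mem T)) addKn.
Qed.

(** By stability, [W'] maps the columns of [S] into their span, on which the inner projection
    [S *m S^T] is the identity. *)
Lemma sym_actionM (W W' : 'M[C]_2) :
  sym_action t W *m sym_action t W' = sym_action t (W *m W').
Proof.
have [M ME] := sym_basis_stable W'.
rewrite /sym_action -!mulmxA ME (mulmxA S^T S) sym_basis_orthonormal mul1mx -ME.
by rewrite (mulmxA (tens_mx _)) tens_mxM.
Qed.

Lemma sym_action1 : sym_action t (1%:M : 'M[C]_2) = 1%:M.
Proof. by rewrite /sym_action tens_mx1 mulmx1 sym_basis_orthonormal. Qed.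

End SymmetricPower.

Lemma induced_op_unit (C : numClosedFieldType) N (t : 'I_N -> nat) (W : 'M[C]_2) :
  W \in unitmx -> induced_op t W \in unitmx.
Proof.
move=> uW; suff : induced_op t W *m induced_op t (invmx W) = 1%:M by case/mulmx1_unit.
rewrite /induced_op tens_mxM -tens_mx1; apply: eq_tens_mx => n.
by rewrite sym_actionM mulmxV // sym_action1.
Qed.

Section Conjugation.
Variables (C : numClosedFieldType) (N : nat) (t : 'I_N -> nat).
Variables (eta : C) (xi : 'I_N -> C).
Local Notation E := 'M[C]_(tdim t).
Variable U : E.

Lemma interp_action_mulr (F : mindex t -> 'rV[C]_(tdim t)) c w e h lam :
  interp_action eta xi F c w e h lam *m U =
  interp_action eta xi (fun h => F h *m U) c w e h lam.
Proof.
rewrite mulmxDl -scalemxAl mulmx_suml; congr (_ + _); apply: eq_bigr => i _.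
rewrite -scalemxAl /shift_bra /ext_bra; case: pickP => //.
by rewrite mul0mx.
Qed.

(** The inner factors [invmx U *m U] telescope, both between operators and next to [v]. *)
Lemma covec_conj (v : 'rV[C]_(tdim t)) (O : C -> E) k1 h : U \in unitmx ->
  covec eta xi (v *m invmx U) (fun lam => U *m O lam *m invmx U) k1 h =
  covec eta xi v O k1 h *m invmx U.
Proof.
move=> uU; have prodU (I : Type) (r : seq I) (F : I -> E) :
    \prod_(i <- r) (U *m F i *m invmx U) = U *m \prod_(i <- r) F i *m invmx U.
  elim: r => [|i r IH]; first by rewrite !big_nil mulmx1 mulmxV.
  by rewrite !big_cons IH -!mulmxE !mulmxA mulmxKV.
rewrite /covec.
under eq_bigr => n _.
  under eq_bigr => k _ do rewrite scalemxAl scalemxAr.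
  rewrite prodU; over.
by rewrite prodU !mulmxA mulmxKV.
Qed.

End Conjugation.

Local Open Scope complex_scope.

Theorem theorem3p2 (R : realType) (N : nat) (t : 'I_N -> nat) (eta : R[i])
    (xi : 'I_N -> R[i]) (K : 'M[R[i]]_2) (k1 k2 : R[i])
    (hN : (0 < N)%N) (ht : forall n, (0 < t n)%N) (heta : eta != 0)
    (hxi : generic_inhom t eta xi)
    (hKinv : K \in unitmx) (hKscal : ~~ is_scalar_mx K)
    (hk : char_poly K = ('X - k1%:P) * ('X - k2%:P)) :
  (K 0 1 != 0 ->
    let A := opA t eta xi K in
    let B := opB t eta xi K in
    let C := opC t eta xi K in
    let D := opD t eta xi K in
    let a := fun_a t eta xi in
    let d := fun_d t eta xi in
    let Sk := covec eta xi (bra0 _ t) A k1 in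
    let b := fun (h : mindex t) lam =>
      K 0 1 * \prod_(n < N) (lam - node t eta xi n (h n)) in
    [/\ covec_basis Sk,
        forall h lam, Sk h *m B lam = b h lam *: Sk h,
        forall h h' : mindex t, h <> h' -> exists lam, b h lam <> b h' lam,
        (forall h lam, Sk h *m A lam =
           interp_action eta xi Sk (K 0 0) (fun x => k1 * a x) 1 h lam) /\
        (forall h lam, Sk h *m D lam =
           interp_action eta xi Sk (K 1 1) (fun x => k2 * d x) (-1) h lam)
      & qdet_rel eta xi k1 k2 A B C D /\
        (forall X : 'M[{poly R[i]}]_(tdim t),
           qdet_rel eta xi k1 k2 A B (poly_op X) D -> poly_op X =1 C)])
  /\
  (K 0 1 = 0 -> forall W : 'M[R[i]]_2, W \in unitmx ->
    let Kb := invmx W *m K *m W in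
    Kb 0 1 != 0 -> Kb 1 0 != 0 ->
    let WW := induced_op t W in
    let conjW := fun (O : R[i] -> 'M[R[i]]_(tdim t)) lam =>
                   WW *m O lam *m invmx WW in
    let A := conjW (opA t eta xi Kb) in
    let B := conjW (opB t eta xi Kb) in
    let D := conjW (opD t eta xi Kb) in
    let a := fun_a t eta xi in
    let d := fun_d t eta xi in
    let Sk := fun h =>
      covec eta xi (bra0 _ t) (opA t eta xi Kb) k1 h *m invmx WW in
    [/\ forall h, Sk h = covec eta xi (bra0 _ t *m invmx WW) A k1 h,
        covec_basis Sk,
        forall (h : mindex t) lam, Sk h *m B lam =
          (Kb 0 1 * \prod_(n < N) (lam - node t eta xi n (h n))) *: Sk h,
        forall h lam, Sk h *m A lam =
          interp_action eta xi Sk (Kb 0 0) (fun x => k1 * a x) 1 h lam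
      & forall h lam, Sk h *m D lam =
          interp_action eta xi Sk (Kb 1 1) (fun x => k2 * d x) (-1) h lam]).
Proof.
(* Comparison of the constant coefficients of the characteristic polynomial. *)
have detK : \det K = k1 * k2.
  have := char_poly_det K; rewrite hk coef0M !coefB !coefX !coefC /= !sub0r.
  by rewrite mulrNN expr2 mulrNN mul1r mul1r => ->.
have detK0 : \det K != 0 by rewrite -unitfE -unitmxE.
split=> [K01|_ W uW].
  split.
  - exact: (covec_is_basis heta hxi detK detK0 K01).
  - exact: (covec_eigen heta hxi detK detK0 K01).
  - move=> h h' /eqP nh; have [lam /eqP e] := bpoly_sep heta hxi K01 nh.
    by exists lam.
  - split; first exact: (covec_opA heta hxi detK detK0 K01).
    exact: (covec_opD heta hxi detK detK0 K01).
  - split; first exact: (monodromy_qdet t eta xi detK).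
    exact: (opC_unique heta hxi detK detK0 K01).
have uWW := induced_op_unit t uW.
set Kb := invmx W *m K *m W => /= Kb01 _.
(* Similarity preserves the determinant, so part a) applies to [Kb] with the same [k1] and [k2]. *)
have detKb : \det Kb = k1 * k2.
  by rewrite !det_mulmx mulrAC -det_mulmx mulVmx // det1 mul1r.
have detKb0 : \det Kb != 0 by rewrite detKb -detK.
have eig h lam := covec_eigen heta hxi detKb detKb0 Kb01 h lam.
set WW := induced_op t W.
have conjE (v : 'rV_(tdim t)) (O : 'M_(tdim t)) :
    v *m invmx WW *m (WW *m O *m invmx WW) = v *m O *m invmx WW.
  by rewrite !mulmxA mulmxKV.
have eigW (h : mindex t) lam :
    covec eta xi (bra0 _ t) (opA t eta xi Kb) k1 h *m invmx WW *m
    (WW *m opB t eta xi Kb lam *m invmx WW) =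
    bpoly t eta xi Kb (fun n => h n) lam *:
      (covec eta xi (bra0 _ t) (opA t eta xi Kb) k1 h *m invmx WW).
  by rewrite conjE eig -scalemxAl.
split.
- by move=> h; apply/esym;
  apply: (covec_conj eta xi (bra0 _ t) (opA t eta xi Kb) k1 h uWW).
- apply: (eigen_basis eigW) => [h||//]; last exact: (bpoly_sep heta hxi Kb01).
  have := covec_neq0 heta hxi detKb detKb0 Kb01 h; apply: contraNneq => e.
  by rewrite -(mulmxKV uWW (covec _ _ _ _ _ _)) e mul0mx.
- exact: eigW.
- move=> h lam; rewrite conjE (covec_opA heta hxi detKb detKb0 Kb01).
  exact: interp_action_mulr.
- move=> h lam; rewrite conjE (covec_opD heta hxi detKb detKb0 Kb01).
  exact: interp_action_mulr.
Qed.
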